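(* Suppose that (A1) $\nabla f$ is $L$-Lipschitz continuous; (A2) $f(x)\ge f_{\mathrm{low}}$ for all $x\in\mathbb{R}^n$; (A3) there is $p\in(0,1)$ such that $|\nabla f(x)|_{(j)}\le \|\nabla f(x)\|/j^{1/p}$ for all $x\in\mathbb{R}^n$ and $j=1,\dots,n$; and (A4) the index $j^*$ defined in the context satisfies $1\le j^*<J-1$. Suppose also that $s_0\le s(\theta,p)\le C s_0$ for some constant $C\ge 1$. If $b\ge c_1(0.22664)$, then, with probability at least $$1-2e^{-\gamma(0.22664)\,m_{j^*}}$$ (over the draw of $z_1,\dots,z_n$), Algorithm 1 requires no more than $\mathcal{O}\left(s(\theta,p)\ln(n)\epsilon^{-2}\right)$ function evaluations to find an $\epsilon$-approximate stationary point of $f$; that is, $FE_{T(\epsilon)}\le K\,s(\theta,p)\ln(n)\,\epsilon^{-2}$, where the constant $K$ depends only on $b$, $C$, $\theta$, $L$, $\sigma_0$ and $f(x_0)-f_{\mathrm{low}}$.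
   Context: Setting: $n\ge 2$, $f:\mathbb{R}^n\to\mathbb{R}$ is differentiable, $L>0$, $f_{\mathrm{low}}\in\mathbb{R}$, $\|\cdot\|$ is the Euclidean norm. $|u|_{(j)}$ denotes the $j$-th largest-in-magnitude component (absolute value) of $u\in\mathbb{R}^n$. Algorithm 1 (ZORO-FA). Inputs: $x_0\in\mathbb{R}^n$, $\epsilon\in(0,1)$, $\theta\in(0,1/2)$, $b\ge 1$, $\sigma_0>0$, an integer $s_0\ge1$ with $\lceil b s_0\ln(n)\rceil\le n/4$, and i.i.d. Rademacher random vectors $z_1,\dots,z_n\in\{-1,1\}^n$ (independent entries, $\pm1$ with equal probability), sampled once at the start. For integers $j\ge 0$ put $s_j=2^j s_0$, $\sigma_j=2^j\sigma_0$, $m_j=\lceil b s_j\ln(n)\rceil$. At iteration $k=0,1,2,\dots$, given $x_k$, for $j=0,1,2,\dots$ do the following. (i) If $m_j<n$: set $h_j=\frac{\theta}{11 n\sigma_j}\epsilon$, $Z^{(j)}=\frac{1}{\sqrt{m_j}}[z_1\ \cdots\ z_{m_j}]^T\in\mathbb{R}^{m_j\times n}$, compute $y_k^{(j)}\in\mathbb{R}^{m_j}$ with entries $[y_k^{(j)}]_i=\frac{f(x_k+h_jz_i)-f(x_k)}{\sqrt{m_j}\,h_j}$, $i=1,\dots,m_j$, and let $g_k^{(j)}$ be the result of $\left\lceil\frac{\log(\theta/4)}{\log(0.5)}\right\rceil$ iterations of CoSaMP, started at $0$, applied to $\min_{\|g\|_0\le s_j}\|Z^{(j)}g-y_k^{(j)}\|_2$.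 (ii) If $m_j\ge n$: set $h_j=\frac{2\theta}{\sigma_j\sqrt n}\epsilon$ and let $g_k^{(j)}\in\mathbb{R}^n$ have entries $[g_k^{(j)}]_\ell=\frac{f(x_k+h_je_\ell)-f(x_k)}{h_j}$, $\ell=1,\dots,n$, with $e_\ell$ the standard basis vectors. (iii) Let $x_{k,j}^+=x_k-\frac1{\sigma_j}g_k^{(j)}$. If $f(x_k)-f(x_{k,j}^+)\ge\frac{1}{2\sigma_j}\epsilon^2$, set $j_k=j$, $x_{k+1}=x_{k,j_k}^+$ and go to iteration $k+1$; otherwise increase $j$ by one. CoSaMP for $\min_{\|v\|_0\le s}\|Zv-y\|_2$ ($\|v\|_0$ is the number of nonzero entries): given $v^\ell$, let $U$ be the union of the support of $v^\ell$ and the indices of the $2s$ largest-in-magnitude entries of $Z^T(y-Zv^\ell)$ (all indices if $2s\ge n$), let $u$ minimize $\|Zu-y\|_2$ over vectors supported in $U$, and let $v^{\ell+1}$ keep the $s$ largest-in-magnitude entries of $u$, setting the others to $0$. $T(\epsilon)=\inf\{k\in\mathbb{N}:\|\nabla f(x_k)\|\le\epsilon\}$. $FE_{T(\epsilon)}$ counts the evaluations of $f$ made in iterations $0,\dots,T(\epsilon)-1$ (at $x_k$, at the points $x_k+h_jz_i$ or $x_k+h_je_\ell$, and at the trial points $x_{k,j}^+$). A point $x$ is $\epsilon$-approximate stationary if $\|\nabla f(x)\|\le\epsilon$. Further quantities: $$s(\theta,p)=\left[\frac4\theta\left(\frac{13.2}{(\frac2p-1)^{1/2}}+\frac{11}{\frac1p-1}\right)\right]^{\frac{2p}{2-p}},\qquad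 J=\left\lceil\log_2\left(\frac{n}{b s_0\ln(n)}\right)\right\rceil,$$ $$j^*=\left\lceil\max\left\{1,\log_2\left(\frac{s(\theta,p)}{s_0}\right),\log_2\left(\frac{(\theta+1)^2}{1-2\theta}\frac{L}{\sigma_0}\right)\right\}\right\rceil,$$ and, with $c_0(a)=\frac{a^2}{4}-\frac{a^3}{6}$ and $s=s_{j^*}$, for $\delta\in(0,1)$, $$c_1(\delta)=\frac{4\left(1+\frac{1+\ln(12/\delta)}{\ln(n/(4s))}\right)}{c_0(\delta/2)},\qquad \gamma(\delta)=c_0\left(\frac\delta2\right)-\frac4b\left(1+\frac{1+\ln(12/\delta)}{\ln(n/(4s))}\right).$$ *)

(* Defs.v *)
From HB Require Import structures.
From mathcomp Require Import all_boot all_order all_algebra.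
From mathcomp Require Import all_classical all_reals all_analysis.

Set Implicit Arguments.
Unset Strict Implicit.
Unset Printing Implicit Defensive.

Import Order.TTheory GRing.Theory Num.Theory numFieldNormedType.Exports.

Local Open Scope classical_set_scope.
Local Open Scope ring_scope.

Section Vectors.
Context {R : realType}.

(* The norm `|u| of the library on matrices is the sup norm; this is the
   Euclidean norm. *)
Definition norm2 (n : nat) (u : 'cV[R]_n) : R :=
  Num.sqrt (\sum_i u i 0 ^+ 2).

(* j-th largest absolute value among the entries of u, for 1 <= j <= n. *)
Definition kth_largest (n : nat) (u : 'cV[R]_n) (j : nat) : R :=
  nth 0 (sort >=%R [seq `|u i 0| | i <- enum 'I_n]) j.-1.

Definition basis_vec (n : nat) (l : 'I_n) : 'cV[R]_n := delta_mx l 0.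

Definition nabla (n : nat) (f : 'cV[R]_n -> R) (x : 'cV[R]_n) : 'cV[R]_n :=
  \col_l 'D_(basis_vec l) (f : 'cV[R]_n -> R^o) x.

Definition supp (n : nat) (u : 'cV[R]_n) : {set 'I_n} := [set i | u i 0 != 0]%SET.

End Vectors.

(* CoSaMP for min_{|v|_0 <= s} |Z v - y|. One step is a relation, not a
   function: ties among the entries and non-unique least-squares minimizers may
   be resolved in any way. *)
Section CoSaMP.
Context {R : realType}.

Definition largest_entries (n k : nat) (u : 'cV[R]_n) (S : {set 'I_n}) : Prop :=
  #|S| = minn k n /\
  forall i l, i \in S -> l \notin S -> `|u l 0| <= `|u i 0|.

Definition cosamp_step (m n : nat) (Z : 'M[R]_(m, n)) (y : 'cV[R]_m) (s : nat)
    (v v' : 'cV[R]_n) : Prop :=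
  exists (W S : {set 'I_n}) (u : 'cV[R]_n),
    [/\ largest_entries (2 * s) (Z^T *m (y - Z *m v)) W,
        supp u \subset supp v :|: W,
        forall w : 'cV[R]_n, supp w \subset supp v :|: W ->
          norm2 (Z *m u - y) <= norm2 (Z *m w - y),
        largest_entries s u S &
        v' = \col_i (if i \in S then u i 0 else 0)].

Fixpoint cosamp (m n : nat) (Z : 'M[R]_(m, n)) (y : 'cV[R]_m) (s N : nat)
    (v : 'cV[R]_n) : Prop :=
  match N with
  | 0 => v = 0
  | N'.+1 => exists2 v', cosamp Z y s N' v' & cosamp_step Z y s v' v
  end.

End CoSaMP.

Section ZoroFA.
Context {R : realType}.
Variables (n : nat) (f : 'cV[R]_n -> R) (x0 : 'cV[R]_n).
Variables (eps theta b sigma0 : R) (s0 : nat).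

Definition s_ (j : nat) : nat := 2 ^ j * s0.
Definition sigma_ (j : nat) : R := 2 ^+ j * sigma0.
Definition m_ (j : nat) : nat := `|Num.ceil (b * (s_ j)%:R * ln n%:R)|%N.

Definition cosamp_iters : nat := `|Num.ceil (ln (theta / 4) / ln (1 / 2))|%N.

(* The i-th row of z is the (transposed) vector z_i. *)
Definition compressed_estimate (z : 'M[R]_n) (x : 'cV[R]_n) (j : nat)
    (lt_mn : (m_ j < n)%N) (g : 'cV[R]_n) : Prop :=
  let h := theta / (11 * n%:R * sigma_ j) * eps in
  let idx (i : 'I_(m_ j)) : 'I_n := widen_ord (ltnW lt_mn) i in
  let Z := \matrix_(i < m_ j, l < n) (z (idx i) l / Num.sqrt (m_ j)%:R) in
  let y := \col_(i < m_ j)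
    ((f (x + h *: (row (idx i) z)^T) - f x) / (Num.sqrt (m_ j)%:R * h)) in
  cosamp Z y (s_ j) cosamp_iters g.

Definition full_estimate (x : 'cV[R]_n) (j : nat) (g : 'cV[R]_n) : Prop :=
  let h := 2 * theta / (sigma_ j * Num.sqrt n%:R) * eps in
  g = \col_l ((f (x + h *: basis_vec l) - f x) / h).

Definition estimate (z : 'M[R]_n) (x : 'cV[R]_n) (j : nat) (g : 'cV[R]_n) : Prop :=
  (forall lt_mn : (m_ j < n)%N, compressed_estimate z x lt_mn g) /\
  ((n <= m_ j)%N -> full_estimate x j g).

Definition trial (x : 'cV[R]_n) (j : nat) (g : 'cV[R]_n) : 'cV[R]_n :=
  x - (sigma_ j)^-1 *: g.

Definition accepted (x : 'cV[R]_n) (j : nat) (g : 'cV[R]_n) : Prop :=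
  (2 * sigma_ j)^-1 * eps ^+ 2 <= f x - f (trial x j g).

(* xs k is the iterate x_k, gs k j the estimate g_k^(j) and js k = Some j_k.
   The estimates beyond j_k are never used.  js k = None means that the inner
   loop of iteration k does not terminate; the following iterates are then
   meaningless and are frozen by convention, and the iteration has infinite
   cost (see evals). *)
Definition zoro_fa_run (z : 'M[R]_n) (xs : nat -> 'cV[R]_n)
    (gs : nat -> nat -> 'cV[R]_n) (js : nat -> option nat) : Prop :=
  [/\ xs 0%N = x0,
      forall k j, estimate z (xs k) j (gs k j) &
      forall k, match js k with
        | Some j => [/\ accepted (xs k) j (gs k j),
            forall i, (i < j)%N -> ~ accepted (xs k) i (gs k i) &
            xs k.+1 = trial (xs k) j (gs k j)]
        | None => (forall j, ~ accepted (xs k) j (gs k j)) /\ xs k.+1 = xs k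
        end].

(* T(eps) = T, i.e. T is the first k with |nabla f(x_k)| <= eps. *)
Definition hitting_time (xs : nat -> 'cV[R]_n) (T : nat) : Prop :=
  norm2 (nabla f (xs T)) <= eps /\
  forall k, (k < T)%N -> eps < norm2 (nabla f (xs k)).

(* Evaluations in one iteration that stops at level jk: one at x_k and, for
   each level j <= jk, one at each of the min(m_j, n) sampling points and one
   at the trial point. *)
Definition evals (jk : option nat) : \bar R :=
  if jk is Some j then (1 + \sum_(i < j.+1) (minn (m_ i) n + 1))%N%:R%:E
  else +oo%E.

Definition FE (js : nat -> option nat) (T : nat) : \bar R :=
  (\sum_(k < T) evals (js k))%E.

End ZoroFA.

Section Constants.
Context {R : realType}.

Definition log2 (x : R) : R := ln x / ln 2.

Definition s_of (theta p : R) : R :=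
  (4 / theta * ((66 / 5) / Num.sqrt (2 / p - 1) + 11 / (1 / p - 1)))
    `^ (2 * p / (2 - p)).

Definition J_of (n : nat) (b : R) (s0 : nat) : int :=
  Num.ceil (log2 (n%:R / (b * s0%:R * ln n%:R))).

Definition jstar (theta p L sigma0 : R) (s0 : nat) : int :=
  Num.ceil (Num.max 1 (Num.max (log2 (s_of theta p / s0%:R))
    (log2 ((theta + 1) ^+ 2 / (1 - 2 * theta) * (L / sigma0))))).

Definition c0 (a : R) : R := a ^+ 2 / 4 - a ^+ 3 / 6.

Definition c1 (n s : nat) (delta : R) : R :=
  4 * (1 + (1 + ln (12 / delta)) / ln (n%:R / (4 * s%:R))) / c0 (delta / 2).

Definition gamma_of (n s : nat) (b delta : R) : R :=
  c0 (delta / 2)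
  - 4 / b * (1 + (1 + ln (12 / delta)) / ln (n%:R / (4 * s%:R))).

End Constants.

Section Rademacher.
Context {R : realType} {d : measure_display} {Om : measurableType d}.
Variable P : probability Om R.

Definition rademacher (X : {RV P >-> R}) : Prop :=
  [/\ forall w, X w = 1 \/ X w = -1,
      P [set w | X w = 1] = (1 / 2)%:E &
      P [set w | X w = -1] = (1 / 2)%:E].

(* Taking some of the B i equal to setT gives the product rule for subfamilies. *)
Definition mutually_independent (I : finType) (X : I -> {RV P >-> R}) : Prop :=
  forall B : I -> set R, (forall i, measurable (B i)) ->
    P [set w | forall i, B i (X i w)] = (\prod_i P (X i @^-1` B i))%E.

(* z (i, l) is the l-th entry of the i-th random vector. *)
Definition iid_rademacher_vectors (n : nat)
    (z : 'I_n * 'I_n -> {RV P >-> R}) : Prop :=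
  (forall il, rademacher (z il)) /\ mutually_independent z.

Definition sample (n : nat) (z : 'I_n * 'I_n -> {RV P >-> R}) (w : Om) : 'M[R]_n :=
  \matrix_(i, l) z (i, l) w.

End Rademacher.

(* Main.v *)
(* A sampled sign matrix with m rows, scaled by 1 / sqrt m, has the restricted
   isometry property of order 4 s with constant delta = 0.22664, outside an event
   of probability 2 exp (- gamma m): this is a union bound of Chernoff estimates
   over the integer points of bounded l1 norm and support at most 4 s, which
   after scaling form a 1/8-net of the sparse unit ball.  Under this property,
   one CoSaMP step at least halves the distance to the best s-term approximation
   of the gradient, up to the noise, and the decay hypothesis on the gradient
   bounds the part of the noise that is due to the discarded entries.  Hence at
   the level j* every non-stationary iterate receives an estimate with relative
   error at most theta, its trial point is accepted, and each iteration stops at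
   a level at most j*, decreases f by at least eps^2 / (2 sigma_{j*}), and costs
   O (s_{j*} ln n) evaluations.

   The sample takes finitely many values, all of them equally likely, so that
   probabilities are cardinals and every event is measurable. *)
Require Import Defs.
From HB Require Import structures.
From mathcomp Require Import all_boot all_order all_algebra.
From mathcomp Require Import all_classical all_reals all_analysis.
From mathcomp Require Import ring lra zify.

Import Order.TTheory GRing.Theory Num.Theory numFieldNormedType.Exports.

Local Open Scope classical_set_scope.
Local Open Scope ring_scope.

Set Implicit Arguments.
Unset Strict Implicit.
Unset Printing Implicit Defensive.

(** * Euclidean norm and restriction to a set of indices *)

Section Euclid.
Context {R : realType}.

(** The vectors z_i are drawn once, so every iterate depends on them and an estimate for one fixed
    gradient could not be reused along the run. The restricted isometry property concerns the matrix
    alone and is uniform in the vector: once it holds, the rest is deterministic and covers every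
    way of breaking ties in CoSaMP. The property only controls sparse vectors, while gradients are
    merely compressible; the discarded entries are therefore measured through an energy bound in the
    l2 and l1 norms. The value of delta enters only through 2/9 <= delta <= 5/22. The upper end
    makes a CoSaMP step contract and lets the cardinal of the net, whose mesh is independent of
    delta, fit under the factor (12 / delta)^k contained in gamma; the lower end makes the Chernoff
    exponent of the upper tail large enough. Passing from the net to all sparse vectors costs a
    factor 4/3, hence the deviation 3 delta / 4 on the net. *)

Definition dot n (u v : 'cV[R]_n) : R := \sum_i u i 0 * v i 0.

Definition restr n (A : {set 'I_n}) (u : 'cV[R]_n) : 'cV[R]_n :=
  \col_i (if i \in A then u i 0 else 0).

Section Dim.
Context {n : nat}.
Implicit Types (u v w : 'cV[R]_n) (A B : {set 'I_n}).

Lemma dotC u v : dot u v = dot v u.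
Proof. by apply: eq_bigr => i _; rewrite mulrC. Qed.

Lemma dotDl u v w : dot (u + v) w = dot u w + dot v w.
Proof. by rewrite -big_split; apply: eq_bigr => i _; rewrite !mxE mulrDl. Qed.

Lemma dotZl a u v : dot (a *: u) v = a * dot u v.
Proof. by rewrite big_distrr; apply: eq_bigr => i _; rewrite !mxE /= mulrA. Qed.

Lemma dotNl u v : dot (- u) v = - dot u v.
Proof. by rewrite -scaleN1r dotZl mulN1r. Qed.

Lemma dotDr u v w : dot w (u + v) = dot w u + dot w v.
Proof. by rewrite dotC dotDl !(dotC w). Qed.

Lemma dotZr a u v : dot u (a *: v) = a * dot u v.
Proof. by rewrite dotC dotZl dotC. Qed.

Lemma dotNr u v : dot u (- v) = - dot u v.
Proof. by rewrite dotC dotNl dotC. Qed.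

Definition dotE := (dotDl, dotDr, dotNl, dotNr, dotZl, dotZr).

Lemma dot_ge0 u : 0 <= dot u u.
Proof. by apply: sumr_ge0 => i _; rewrite -expr2 sqr_ge0. Qed.

Lemma sqr_norm2 u : norm2 u ^+ 2 = dot u u.
Proof.
rewrite /norm2 sqr_sqrtr; last by apply: sumr_ge0 => i _; exact: sqr_ge0.
by apply: eq_bigr => i _; rewrite expr2.
Qed.

Lemma norm2_ge0 u : 0 <= norm2 u.
Proof. exact: sqrtr_ge0. Qed.

Lemma norm2_eq0 u : norm2 u = 0 -> u = 0.
Proof.
move=> u0; have : dot u u = 0 by rewrite -sqr_norm2 u0 expr0n.
move/eqP; rewrite /dot psumr_eq0; last by move=> i _; rewrite -expr2 sqr_ge0.
move=> /allP uz; apply/colP => i; rewrite mxE; apply/eqP.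
by have := uz i (mem_index_enum i); rewrite /= mulf_eq0 orbb.
Qed.

Lemma norm2_0 : norm2 (0 : 'cV[R]_n) = 0.
Proof. by rewrite /norm2 big1 ?sqrtr0 // => i _; rewrite mxE expr0n. Qed.

Lemma norm2Z a u : norm2 (a *: u) = `|a| * norm2 u.
Proof.
apply/eqP; rewrite -(@eqrXn2 _ 2) ?norm2_ge0 ?mulr_ge0 ?norm2_ge0 //.
by rewrite exprMn !sqr_norm2 dotZl dotZr real_normK ?num_real // mulrA expr2.
Qed.

Lemma norm2N u : norm2 (- u) = norm2 u.
Proof. by rewrite -scaleN1r norm2Z normrN1 mul1r. Qed.

Lemma dot_le_norm2 u v : dot u v <= norm2 u * norm2 v.
Proof.
set a := norm2 u; set b := norm2 v.
have [a0|a_neq0] := eqVneq a 0.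
  by rewrite (norm2_eq0 a0) a0 mul0r /dot big1 // => i _; rewrite mxE mul0r.
have [b0|b_neq0] := eqVneq b 0.
  by rewrite (norm2_eq0 b0) b0 mulr0 /dot big1 // => i _; rewrite mxE mulr0.
have a_gt0 : 0 < a by rewrite lt_def a_neq0 norm2_ge0.
have b_gt0 : 0 < b by rewrite lt_def b_neq0 norm2_ge0.
have := dot_ge0 (b *: u - a *: v).
rewrite !dotE -!sqr_norm2 -/a -/b (dotC v u) => h.
have ab : 0 < a * b by exact: mulr_gt0.
rewrite -subr_ge0 -(pmulr_rge0 _ ab) -(pmulr_rge0 _ (ltr0Sn _ 1)).
by apply: le_trans h _; rewrite le_eqVlt; apply/orP; left; apply/eqP; ring.
Qed.

Lemma norm_dot_le u v : `|dot u v| <= norm2 u * norm2 v.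
Proof.
by rewrite ler_norml dot_le_norm2 andbT lerNl -dotNl -(norm2N u) dot_le_norm2.
Qed.

Lemma norm2D u v : norm2 (u + v) <= norm2 u + norm2 v.
Proof.
rewrite -(@ler_pXn2r _ 2) ?nnegrE ?addr_ge0 ?norm2_ge0 //.
rewrite sqr_norm2 !dotE (dotC v u) sqrrD !sqr_norm2.
by have := dot_le_norm2 u v; lra.
Qed.

Lemma norm2B u v : norm2 (u - v) <= norm2 u + norm2 v.
Proof. by rewrite -(norm2N v) norm2D. Qed.

Lemma restrE A u i : restr A u i 0 = if i \in A then u i 0 else 0.
Proof. by rewrite mxE. Qed.

Lemma supp_restr A u : supp (restr A u) \subset A.
Proof.
by apply/fintype.subsetP => i; rewrite inE restrE; case: ifP => //; rewrite eqxx.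
Qed.

Lemma supp_restr_sub A u : supp (restr A u) \subset supp u.
Proof.
by apply/fintype.subsetP => i; rewrite !inE restrE; case: ifP => //; rewrite eqxx.
Qed.

Lemma suppP u A : reflect (forall i, i \notin A -> u i 0 = 0) (supp u \subset A).
Proof.
apply: (iffP fintype.subsetP) => h i.
  by move=> iA; apply: contraNeq iA => ui; apply: h; rewrite inE.
by rewrite inE => ui; apply: contraNT ui => iA; rewrite (h _ iA).
Qed.

Lemma supp0 : supp (0 : 'cV[R]_n) = finset.set0.
Proof. by apply/setP => i; rewrite !inE mxE eqxx. Qed.

Lemma suppN u : supp (- u) = supp u.
Proof. by apply/setP => i; rewrite !inE mxE oppr_eq0. Qed.

Lemma supp_scale a u : supp (a *: u) \subset supp u.
Proof.
apply/fintype.subsetP => i; rewrite !inE mxE; apply: contraNneq => ->.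
by rewrite mulr0.
Qed.

Lemma suppD u v : supp (u + v) \subset supp u :|: supp v.
Proof.
apply/fintype.subsetP => i; rewrite !inE mxE; apply: contraNT.
by rewrite negb_or !negbK => /andP[/eqP-> /eqP->]; rewrite addr0.
Qed.

Lemma suppB u v : supp (u - v) \subset supp u :|: supp v.
Proof. by rewrite -(suppN v) suppD. Qed.

Lemma restr_id u A : supp u \subset A -> restr A u = u.
Proof.
move=> /suppP uA; apply/colP => i; rewrite mxE.
by case: ifP => // /negbT/uA ->.
Qed.

Lemma restrD A u v : restr A (u + v) = restr A u + restr A v.
Proof. by apply/colP => i; rewrite !mxE; case: ifP => // _; rewrite addr0. Qed.

Lemma restrN A u : restr A (- u) = - restr A u.
Proof. by apply/colP => i; rewrite !mxE; case: ifP => // _; rewrite oppr0. Qed.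

Lemma restr_split A u : u = restr A u + restr (~: A) u.
Proof.
by apply/colP => i; rewrite !mxE inE; case: ifP => _; rewrite ?addr0 ?add0r.
Qed.

Lemma sqr_norm2_restr A u : norm2 (restr A u) ^+ 2 = \sum_(i in A) u i 0 ^+ 2.
Proof.
rewrite sqr_norm2 /dot [RHS]big_mkcond; apply: eq_bigr => i _.
by rewrite mxE; case: ifP => _; rewrite ?expr2 ?mulr0.
Qed.

Lemma sqr_norm2_split A u :
  norm2 u ^+ 2 = norm2 (restr A u) ^+ 2 + norm2 (restr (~: A) u) ^+ 2.
Proof.
rewrite !sqr_norm2_restr sqr_norm2 /dot (bigID (mem A)) /=.
by congr (_ + _); apply: eq_big => i; rewrite ?inE ?expr2.
Qed.

Lemma dot_restr A u v : dot (restr A u) v = dot (restr A u) (restr A v).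
Proof.
by apply: eq_bigr => i _; rewrite !mxE; case: ifP => // _; rewrite !mul0r.
Qed.

Lemma dot_restr_self A u : dot (restr A u) u = norm2 (restr A u) ^+ 2.
Proof. by rewrite sqr_norm2 dot_restr. Qed.

Lemma ler_sqr_norm2 u v : (norm2 u ^+ 2 <= norm2 v ^+ 2) = (norm2 u <= norm2 v).
Proof. by rewrite ler_pXn2r // nnegrE norm2_ge0. Qed.

Lemma norm2_restr_le A u : norm2 (restr A u) <= norm2 u.
Proof. by rewrite -ler_sqr_norm2 (sqr_norm2_split A u) lerDl sqr_ge0. Qed.

End Dim.

Lemma dot_mulmx m n (Z : 'M[R]_(m, n)) (u : 'cV[R]_n) (v : 'cV[R]_m) :
  dot (Z *m u) v = dot u (Z^T *m v).
Proof.
rewrite /dot; under eq_bigr do rewrite mxE big_distrl /=.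
rewrite exchange_big; apply: eq_bigr => j _; rewrite mxE big_distrr /=.
by apply: eq_bigr => i _; rewrite mxE; ring.
Qed.

End Euclid.

(** * Best k-term approximation *)

Section Largest.
Context {R : realType} {n : nat}.
Implicit Types (u v w : 'cV[R]_n) (A B S W : {set 'I_n}).

Lemma ler_sum_separated (F : 'I_n -> R) A B : (#|A| <= #|B|)%N ->
  (forall i, 0 <= F i) -> (forall i j, i \in A -> j \in B -> F i <= F j) ->
  \sum_(i in A) F i <= \sum_(i in B) F i.
Proof.
move=> AB F0 FAB; have [->|[a0 a0A]] := set_0Vmem A.
  by rewrite big_set0 sumr_ge0.
set a := [arg max_(i > a0 in A) F i]%O.
have [aA amax] : a \in A /\ forall i, i \in A -> F i <= F a.
  by rewrite /a; case: arg_maxP => // i iA imax; split=> // j /imax.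
apply: (@le_trans _ _ (\sum_(i in A) F a)); first exact: ler_sum.
apply: (@le_trans _ _ (\sum_(i in B) F a)); last by apply: ler_sum => j; exact: FAB.
by rewrite !sumr_const -[leLHS]mulr_natr -[leRHS]mulr_natr ler_wpM2l ?ler_nat.
Qed.

(** Both sets lose the same intersection, so [A :\: W] has at most as many elements as [W :\: A],
    and each of its entries is dominated by each entry of the latter. *)
Lemma largest_sum k u W A : largest_entries k u W -> (#|A| <= minn k n)%N ->
  \sum_(i in A :\: W) u i 0 ^+ 2 <= \sum_(i in W :\: A) u i 0 ^+ 2.
Proof.
move=> [cW topW] cA; apply: ler_sum_separated => [|i|i j].
- have := cardsID W A; have := cardsID A W; rewrite (finset.setIC A W) cW; lia.
- exact: sqr_ge0.
- rewrite !inE => /andP[iW _] /andP[_ jW].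
  by rewrite -(real_normK (num_real (u i 0))) -(real_normK (num_real (u j 0)))
    ler_pXn2r ?nnegrE //; apply: topW.
Qed.

(** The error of [w] is at least the energy of [u] outside [supp w], and exchanging [supp w] for [W]
    can only lower that energy. *)
Lemma largest_best k u w W : largest_entries k u W -> (#|supp w| <= k)%N ->
  norm2 (restr (~: W) u) <= norm2 (u - w).
Proof.
move=> topW cw; rewrite -ler_sqr_norm2 (sqr_norm2_split (supp w) (u - w)).
apply: le_trans (_ : norm2 (restr (~: supp w) u) ^+ 2 <= _); last first.
  have -> : restr (~: supp w) (u - w) = restr (~: supp w) u.
    apply/colP => i; rewrite !mxE !inE; case: eqVneq => //= ->.
    by rewrite oppr0 addr0.
  by rewrite lerDr sqr_ge0.
have cw' : (#|supp w| <= minn k n)%N.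
  by rewrite leq_min cw -[X in (_ <= X)%N]card_ord max_card.
have := largest_sum topW cw'.
have e (A : {set 'I_n}) : norm2 (restr (~: A) u) ^+ 2 =
    norm2 u ^+ 2 - norm2 (restr A u) ^+ 2.
  by rewrite (sqr_norm2_split A u); ring.
have splitw := big_setID (R := R) (idx := 0) (aop := +%R) (A := supp w) W (fun i => u i 0 ^+ 2).
have splitW := big_setID (R := R) (idx := 0) (aop := +%R) (A := W) (supp w) (fun i => u i 0 ^+ 2).
rewrite /= in splitw splitW; rewrite (finset.setIC W) in splitW.
by rewrite !e !sqr_norm2_restr splitw splitW; lra.
Qed.

End Largest.

(** * Restricted isometry and CoSaMP *)

Definition rip {R : realType} m n (Z : 'M[R]_(m, n)) (k : nat) (delta : R) : Prop :=
  forall x : 'cV[R]_n, (#|supp x| <= k)%N ->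
    `|norm2 (Z *m x) ^+ 2 - norm2 x ^+ 2| <= delta * norm2 x ^+ 2.

Section RIP.
Context {R : realType} {m n : nat}.
Variables (Z : 'M[R]_(m, n)) (k : nat) (delta : R).
Hypothesis ripZ : rip Z k delta.
Hypothesis delta_ge0 : 0 <= delta.
Implicit Types (x u v w : 'cV[R]_n) (e : 'cV[R]_m).

Lemma rip_norm2 x : (#|supp x| <= k)%N ->
  norm2 (Z *m x) <= Num.sqrt (1 + delta) * norm2 x.
Proof.
move=> /ripZ; rewrite ler_norml => /andP[_ h].
have d1 : 0 <= 1 + delta by rewrite addr_ge0.
rewrite -(@ler_pXn2r _ 2) ?nnegrE ?norm2_ge0 ?mulr_ge0 ?norm2_ge0 ?sqrtr_ge0 //.
by rewrite exprMn (sqr_sqrtr d1) mulrDl mul1r -lerBlDl.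
Qed.

(* Polarization, after rescaling both arguments to the same norm. *)
Lemma rip_dot u v : (#|supp u :|: supp v| <= k)%N ->
  `|dot (Z *m u) (Z *m v) - dot u v| <= delta * norm2 u * norm2 v.
Proof.
move=> cuv.
have [u0|u_neq0] := eqVneq (norm2 u) 0.
  rewrite (norm2_eq0 u0) mulmx0 /dot !big1 => [|i _|i _]; try by rewrite [X in X * _]mxE mul0r.
  by rewrite subrr normr0 !mulr_ge0 ?norm2_ge0.
have [v0|v_neq0] := eqVneq (norm2 v) 0.
  rewrite (norm2_eq0 v0) mulmx0 /dot !big1 => [|i _|i _]; try by rewrite [X in _ * X]mxE mulr0.
  by rewrite subrr normr0 !mulr_ge0 ?norm2_ge0.
have a_gt0 : 0 < norm2 u by rewrite lt_def u_neq0 norm2_ge0.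
have b_gt0 : 0 < norm2 v by rewrite lt_def v_neq0 norm2_ge0.
set a := norm2 u in a_gt0 *; set b := norm2 v in b_gt0 *.
have supp_comb c d : (#|supp (c *: u + d *: v)| <= k)%N.
  apply: leq_trans cuv; apply/subset_leq_card/(fintype.subset_trans (suppD _ _)).
  by apply: finset.setUSS; apply: supp_scale.
(* The squared norms of b u + a v and b u - a v differ by 4 a b times the inner product and add up
   to 4 a^2 b^2, which leaves exactly delta a b. *)
move: (ripZ (supp_comb b a)) (ripZ (supp_comb b (- a))).
 rewrite !sqr_norm2 !mulmxDr -!scalemxAr !dotE -!sqr_norm2 -/a -/b.
rewrite (dotC (Z *m v)) (dotC v u).
set p := dot (Z *m u) _; set q := dot u v.
set P := norm2 (Z *m u) ^+ 2; set Q := norm2 (Z *m v) ^+ 2.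
rewrite !ler_norml => /andP[hp1 hp2] /andP[hm1 hm2].
have ab : 0 < 4 * (a * b) by rewrite !mulr_gt0.
by apply/andP; split; rewrite -(ler_pM2l ab); lra.
Qed.

Lemma rip_adjoint (M : {set 'I_n}) u : supp u \subset M -> (#|M| <= k)%N ->
  forall e, `|dot (Z *m u) e| <= Num.sqrt (1 + delta) * norm2 u * norm2 e.
Proof.
move=> uM cM e; apply: le_trans (norm_dot_le _ _) _.
rewrite ler_wpM2r ?norm2_ge0 // rip_norm2 //.
exact: leq_trans (subset_leq_card uM) cM.
Qed.

End RIP.

Section CosampAnalysis.
Context {R : realType} {m n : nat}.
Variables (Z : 'M[R]_(m, n)) (s : nat) (delta : R) (x : 'cV[R]_n) (e : 'cV[R]_m).
Hypothesis ripZ : rip Z (4 * s) delta.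
Hypothesis delta_ge0 : 0 <= delta.
Hypothesis cx : (#|supp x| <= s)%N.
Let y := Z *m x + e.
Let E := Num.sqrt (1 + delta) * norm2 e.

Lemma E_ge0 : 0 <= E.
Proof. by rewrite mulr_ge0 ?sqrtr_ge0 ?norm2_ge0. Qed.

(** The proxy [r] is close to [d = x - v] on small sets. By the choice of [W], [r] has no more
    energy on [A] than on [B], where [d] vanishes; so the part of [d] missed by [W] is at most the
    sum of the deviations [r - d] on [A] and on [B], that is sqrt 2 times the deviation on [M].
    Squaring gives the factor 2. *)
Lemma cosamp_identification v W : (#|supp v| <= s)%N ->
  largest_entries (2 * s) (Z^T *m (y - Z *m v)) W ->
  norm2 (restr (~: (supp v :|: W)) x) ^+ 2 <=
    2 * (delta * norm2 (x - v) + E) ^+ 2.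
Proof.
move=> cv topW; set d := x - v; set r := Z^T *m _ in topW.
set D := supp x :|: supp v.
have cD : (#|D| <= 2 * s)%N.
  by have := finset.cardsU (supp x) (supp v); rewrite -/D; lia.
have suppd : supp d \subset D by exact: suppB.
have cW : (#|W| <= 2 * s)%N by have [-> _] := topW; exact: geq_minl.
set A := (D :\: W)%SET; set B := (W :\: D)%SET; set M := (A :|: B)%SET.
have cMD : (#|M :|: D| <= 4 * s)%N.
  have : (M :|: D)%SET \subset (D :|: W)%SET.
    by apply/fintype.subsetP => i; rewrite !inE; do ?case: (_ \in _); do ?case: (_ != 0).
  by move=> /subset_leq_card; have := finset.cardsU D W; lia.
set eta := restr M (r - d).
have etaM : supp eta \subset M by exact: supp_restr.
(* Testing [r - d] against [eta] gives the squared norm of [eta] on one side, and on the other an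
   inner product that the isometry preserves up to delta, plus the noise. *)
have heta : norm2 eta <= delta * norm2 d + E.
  have [->|eta_neq0] := eqVneq (norm2 eta) 0.
    by rewrite addr_ge0 ?E_ge0 ?mulr_ge0 ?norm2_ge0.
  have eta_gt0 : 0 < norm2 eta by rewrite lt_def eta_neq0 norm2_ge0.
  rewrite -(ler_pM2l eta_gt0) -expr2 -dot_restr_self -/eta dotDr dotNr.
  have rE : r = Z^T *m (Z *m d) + Z^T *m e.
    by rewrite /r /y -mulmxDr; congr (_ *m _); rewrite /d mulmxBr addrAC.
  have -> : dot eta r = dot (Z *m eta) (Z *m d) + dot (Z *m eta) e.
    by rewrite rE dotDr -!dot_mulmx.
  have c1 : (#|supp eta :|: supp d| <= 4 * s)%N.
    by apply: leq_trans cMD; apply/subset_leq_card/finset.setUSS.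
  have c2 : (#|M| <= 4 * s)%N.
    by apply: leq_trans cMD; apply/subset_leq_card/finset.subsetUl.
  have := rip_dot ripZ delta_ge0 c1; have := rip_adjoint ripZ delta_ge0 etaM c2 e.
  rewrite !ler_norml => /andP[_ h1] /andP[_ h2].
  by rewrite mulrDr /E; lra.
have AB : norm2 (restr A r) <= norm2 (restr B r).
  rewrite -ler_sqr_norm2 !sqr_norm2_restr; apply: (largest_sum topW).
  rewrite leq_min cD /=; apply: leq_trans (max_card _) _.
  by rewrite card_ord.
have dB : restr B d = 0.
  apply/colP => i; rewrite !mxE !inE; case: ifP => // /andP[+ _].
  by rewrite negb_or !negbK => /andP[/eqP-> /eqP->]; rewrite subrr.
have a1 : norm2 (restr A d) <= norm2 (restr A (r - d)) + norm2 (restr B (r - d)).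
  have -> : restr A d = restr A r - restr A (r - d).
    by rewrite [restr A (r - d)]restrD restrN opprD opprK addNKr.
  apply: le_trans (norm2B _ _) _; rewrite addrC lerD2l.
  by rewrite [restr B (r - d)]restrD restrN dB subr0.
have eta2 : norm2 eta ^+ 2 = norm2 (restr A (r - d)) ^+ 2 + norm2 (restr B (r - d)) ^+ 2.
  rewrite !sqr_norm2_restr !(big_mkcond (fun i => i \in _)) -big_split /=.
  apply: eq_bigr => i _; rewrite !finset.in_setU !finset.in_setD.
  by case: (i \in W); case: (i \in D); rewrite ?addr0 ?add0r.
have a2 : norm2 (restr (~: (supp v :|: W)) x) <= norm2 (restr A d).
  have -> : restr (~: (supp v :|: W)) x = restr (~: (supp v :|: W)) d.
    apply/colP => i; rewrite !mxE !inE; case: eqVneq => //= ->.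
    by rewrite subr0.
  rewrite -ler_sqr_norm2 !sqr_norm2_restr [leLHS]big_mkcond [leRHS]big_mkcond.
  apply: ler_sum => i _; rewrite !inE negb_or negbK.
  have [iW|iW] /= := boolP (i \in W); first by rewrite andbF.
  rewrite andbT; have [v0|v0] /= := eqVneq (v i 0) 0; last by case: ifP => // _; rewrite sqr_ge0.
  by rewrite orbF; case: eqVneq => //= x0; rewrite !mxE x0 v0 subrr expr0n.
have e0 := norm2_ge0 eta.
apply: le_trans (_ : 2 * norm2 eta ^+ 2 <= _); last first.
  rewrite ler_pM2l // ler_pXn2r ?nnegrE //.
  by rewrite addr_ge0 ?E_ge0 ?mulr_ge0 ?norm2_ge0.
set al := norm2 (restr A (r - d)) in a1 eta2 *.
set be := norm2 (restr B (r - d)) in a1 eta2 *.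
apply: le_trans (_ : (al + be) ^+ 2 <= _).
  rewrite ler_pXn2r ?nnegrE ?addr_ge0 ?norm2_ge0 //; exact: le_trans a1.
by rewrite eta2; have := sqr_ge0 (al - be); lra.
Qed.

(** By the normal equations the residual is orthogonal to the image of every vector supported in
    [U]; this is used on the restriction of [x - u] itself, where the isometry compares the inner
    products before and after [Z]. *)
Lemma cosamp_least_squares u (U : {set 'I_n}) : (#|U| <= 3 * s)%N ->
  supp u \subset U ->
  (forall w, supp w \subset U -> norm2 (Z *m u - y) <= norm2 (Z *m w - y)) ->
  norm2 (restr U (x - u)) <= delta * norm2 (x - u) + E.
Proof.
move=> cU uU min_u.
have normal_eq w : supp w \subset U -> dot (Z *m w) (Z *m u - y) = 0.
  move=> wU; set c := dot _ _; set N := norm2 (Z *m w) ^+ 2.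
  have N0 : 0 <= N by exact: sqr_ge0.
  have h t : 0 <= 2 * t * c + t ^+ 2 * N.
    have : supp (u + t *: w) \subset U.
      apply: fintype.subset_trans (suppD _ _) _; rewrite finset.subUset uU /=.
      exact: fintype.subset_trans (supp_scale _ _) wU.
    move=> /min_u; rewrite -ler_sqr_norm2 mulmxDr -scalemxAr addrAC.
    rewrite !sqr_norm2 ![dot (_ + _ *: _) _]dotDl ![dot _ (_ + _ *: _)]dotDr !dotZl !dotZr.
    rewrite (dotC _ (Z *m w)) -/c -(sqr_norm2 (Z *m w)) -/N.
    by nra.
  have N1 : 0 < N + 1 by lra.
  (* The optimal shift would be - c / N; dividing by N + 1 still forces c = 0 and spares the case N
     = 0. *)
  have := h (- c / (N + 1)).
  have -> : 2 * (- c / (N + 1)) * c + (- c / (N + 1)) ^+ 2 * N =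
     - (c ^+ 2 * (N + 2) / (N + 1) ^+ 2).
    by field; rewrite lt0r_neq0.
  rewrite oppr_ge0 pmulr_lle0 ?invr_gt0 ?exprn_gt0 // pmulr_lle0; last by lra.
  by move=> c0; apply/eqP; rewrite -sqrf_eq0 eq_le c0 sqr_ge0.
set w := restr U (x - u).
have wU : supp w \subset U by exact: supp_restr.
have [->|w_neq0] := eqVneq (norm2 w) 0.
  by rewrite addr_ge0 ?E_ge0 ?mulr_ge0 ?norm2_ge0.
have w_gt0 : 0 < norm2 w by rewrite lt_def w_neq0 norm2_ge0.
rewrite -(ler_pM2l w_gt0) -expr2 -dot_restr_self -/w.
have c1 : (#|supp w :|: supp (x - u)| <= 4 * s)%N.
  have : (supp w :|: supp (x - u))%SET \subset (supp x :|: U)%SET.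
    rewrite finset.subUset; apply/andP; split.
      exact: fintype.subset_trans wU (finset.subsetUr _ _).
    by apply: fintype.subset_trans (suppB _ _) _; apply: finset.setUSS.
  by move=> /subset_leq_card; have := finset.cardsU (supp x) U; lia.
have c2 : (#|U| <= 4 * s)%N by lia.
have := rip_dot ripZ delta_ge0 c1; have := rip_adjoint ripZ delta_ge0 wU c2 e.
have : dot (Z *m w) (Z *m (x - u)) = - dot (Z *m w) e.
  have -> : Z *m (x - u) = - (Z *m u - y) - e.
    by rewrite mulmxBr opprB /y addrAC addrK.
  by rewrite dotDr !dotNr normal_eq // oppr0 add0r.
move=> ->; rewrite !ler_norml => /andP[h1 _] /andP[h2 _].
by rewrite mulrDr /E; lra.
Qed.

(* Foucart's estimate: the off-support part is controlled by the
   identification step, the rest by least squares, and pruning at most doubles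
   the latter. *)
Lemma cosamp_step_bound v v' : delta <= 5 / 22 -> (#|supp v| <= s)%N ->
  cosamp_step Z y s v v' ->
  (#|supp v'| <= s)%N /\ norm2 (x - v') <= norm2 (x - v) / 2 + 4 * E.
Proof.
move=> delta_le cv [W [T [u [topW uU min_u topT ->]]]].
set v1 := \col_i _; have v1E : v1 = restr T u by [].
have cT : (#|T| <= s)%N by have [-> _] := topT; exact: geq_minl.
have cv1 : (#|supp v1| <= s)%N.
  exact: leq_trans (subset_leq_card (supp_restr T u)) cT.
split=> //.
set U := (supp v :|: W)%SET in uU min_u.
have cU : (#|U| <= 3 * s)%N.
  have [cW _] := topW; have := geq_minl (2 * s) n; rewrite -cW.
  by have := finset.cardsU (supp v) W; rewrite -/U; lia.
have hb := cosamp_identification cv topW; rewrite -/U in hb.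
have ha := cosamp_least_squares cU uU min_u.
set al := norm2 (restr U (x - u)) in ha.
set be := norm2 (restr (~: U) x) in hb.
have offU : restr (~: U) (x - u) = restr (~: U) x.
  rewrite restrD restrN; apply/colP => i; rewrite !mxE inE.
  case: ifP => [iU|]; last by rewrite subr0.
  by move/suppP: uU => ->; rewrite ?subr0.
have xu : norm2 (x - u) <= al + be.
  by rewrite (restr_split U (x - u)) offU norm2D.
have offU' : restr (~: U) (x - v1) = restr (~: U) x.
  rewrite restrD restrN; apply/colP => i; rewrite !mxE inE.
  case: ifP => [iU|]; last by rewrite subr0.
  by move/suppP: uU => ->; rewrite ?subr0 ?if_same ?subr0.
(* The entries of [u] dropped by pruning weigh no more than the distance from [u] to the s-sparse
   vector [restr U x], which is [al] again. *)
have prune : norm2 (restr U (x - v1)) <= 2 * al.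
  have -> : x - v1 = (x - u) + restr (~: T) u.
    by rewrite v1E {2}(restr_split T u) opprD addrA addrNK.
  rewrite restrD; apply: le_trans (norm2D _ _) _.
  suff : norm2 (restr U (restr (~: T) u)) <= al by rewrite -/al; lra.
  apply: le_trans (norm2_restr_le _ _) _.
  have cxU : (#|supp (restr U x)| <= s)%N.
    exact: leq_trans (subset_leq_card (supp_restr_sub U x)) cx.
  apply: le_trans (largest_best topT cxU) _.
  by rewrite -[in leLHS](restr_id uU) -restrN -restrD -norm2N -restrN opprB.
set D := norm2 (x - v) in hb *.
have D0 : 0 <= D by exact: norm2_ge0.
have E0 := E_ge0.
have al0 : 0 <= al by exact: norm2_ge0.
have be0 : 0 <= be by exact: norm2_ge0.
have hsq : norm2 (x - v1) ^+ 2 <= be ^+ 2 + (2 * al) ^+ 2.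
  rewrite (sqr_norm2_split U (x - v1)) offU' addrC lerD2l.
  by rewrite ler_pXn2r ?nnegrE ?norm2_ge0 ?mulr_ge0.
have dD : delta * D <= 5 / 22 * D by exact: ler_wpM2r.
have dD0 : 0 <= delta * D by exact: mulr_ge0.
(* 17/12 is a rational upper bound of sqrt 2. *)
have hb1 : be <= 17 / 12 * (5 / 22 * D + E).
  rewrite -(@ler_pXn2r _ 2) ?nnegrE //; last by lra.
  apply: le_trans hb _; rewrite exprMn.
  apply: ler_pM; rewrite ?sqr_ge0 //; first by lra.
  by rewrite ler_pXn2r ?nnegrE //; lra.
have ha1 : al <= 5 / 22 * (al + be) + E.
  apply: le_trans ha _; rewrite lerD2r; apply: ler_pM => //; exact: norm2_ge0.
have hb2 : be <= D / 3 + 3 / 2 * E by lra.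
have ha2 : al <= D / 10 + 7 / 4 * E by lra.
(* After squaring, the coefficients of D^2, D E and E^2 are 1/9 + 1/25, 1 + 7/5 and 9/4 + 49/4,
   below the 1/4, 4 and 16 of (D / 2 + 4 E)^2. *)
rewrite -(@ler_pXn2r _ 2) ?nnegrE ?norm2_ge0 //; last by lra.
apply: le_trans hsq _.
have q1 : be ^+ 2 <= (D / 3 + 3 / 2 * E) ^+ 2.
  by rewrite ler_pXn2r ?nnegrE //; lra.
have q2 : (2 * al) ^+ 2 <= (2 * (D / 10 + 7 / 4 * E)) ^+ 2.
  by rewrite ler_pXn2r ?nnegrE //; lra.
have DE : 0 <= D * E by exact: mulr_ge0.
by have := sqr_ge0 D; have := sqr_ge0 E; nra.
Qed.

(** 8 E is the fixed point of the one-step recursion t -> t / 2 + 4 E. *)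
Lemma cosamp_bound N v : delta <= 5 / 22 -> cosamp Z y s N v ->
  (#|supp v| <= s)%N /\ norm2 (x - v) <= norm2 x / 2 ^+ N + 8 * E.
Proof.
move=> delta_le; have E0 := E_ge0; elim: N v => [v ->|N IHN v].
  by rewrite supp0 finset.cards0 subr0 expr0 divr1; split=> //; lra.
move=> [v0 /IHN[cv0 hv0] /(cosamp_step_bound delta_le cv0)[cv hv]]; split=> //.
have -> : norm2 x / 2 ^+ N.+1 = norm2 x / 2 ^+ N / 2 by rewrite exprSr invfM mulrA.
by apply: le_trans hv _; move: E0 hv0; move: (norm2 x / 2 ^+ N) => q; lra.
Qed.

End CosampAnalysis.

(** * Energy bound for vectors that are not sparse *)

Section Energy.
Context {R : realType} {m n : nat}.
Variables (Z : 'M[R]_(m, n)) (s : nat) (delta : R).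
Hypothesis ripZ : rip Z s delta.
Hypothesis delta_ge0 : 0 <= delta.
Hypothesis s_gt0 : (0 < s)%N.
Let kap := Num.sqrt (1 + delta).

Definition norm1 (u : 'cV[R]_n) : R := \sum_i `|u i 0|.

Lemma norm1_split (A : {set 'I_n}) u :
  norm1 u = norm1 (restr A u) + norm1 (restr (~: A) u).
Proof.
rewrite /norm1 -big_split; apply: eq_bigr => i _; rewrite !mxE inE /=.
by case: ifP => _; rewrite normr0 ?addr0 ?add0r.
Qed.

Lemma exists_largest k (u : 'cV[R]_n) : (k <= n)%N -> exists A, largest_entries k u A.
Proof.
move=> kn; elim: k kn => [|k IHk] kn.
  exists finset.set0; split; first by rewrite finset.cards0 min0n.
  by move=> i l; rewrite inE.
have [A [cA topA]] := IHk (ltnW kn).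
rewrite (minn_idPl (ltnW kn)) in cA.
have [i0 i0A] : exists i0, i0 \notin A.
  have [i0] : exists i0, i0 \in ~: A.
    by apply/set0Pn; rewrite -card_gt0; have := cardsC A; rewrite card_ord cA; lia.
  by rewrite inE; exists i0.
have [a aA amax] : exists2 a, a \notin A & forall i, i \notin A -> `|u i 0| <= `|u a 0|.
  case: (@arg_maxP _ _ _ i0 (fun i => i \notin A) (fun i => `|u i 0|) i0A).
  by move=> a aA amax; exists a.
exists (a |: A)%SET; split; first by rewrite cardsU1 aA cA (minn_idPl kn).
move=> i l; rewrite !inE negb_or => /orP[/eqP->|iA] /andP[_ lA]; first exact: amax.
exact: topA.
Qed.

Lemma largest_tail_le (u : 'cV[R]_n) A : (s <= n)%N -> largest_entries s u A ->
  forall i, `|restr (~: A) u i 0| <= norm1 (restr A u) / s%:R.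
Proof.
move=> sn [cA topA] i; rewrite (minn_idPl sn) in cA.
rewrite ler_pdivlMr ?ltr0n // mxE inE.
case: ifP => iA; last by rewrite normr0 mul0r sumr_ge0.
rewrite /norm1 mulr_natr -cA -sumr_const.
rewrite big_mkcond; apply: ler_sum => j _; rewrite mxE.
by case: ifP => jA //; exact: topA.
Qed.

(* Induction on the support: the s largest entries are peeled off, and the rest
   is bounded entrywise by their mean. *)
Lemma rip_norm1 (M : R) (u : 'cV[R]_n) : (forall i, `|u i 0| <= M) -> 0 <= M ->
  norm2 (Z *m u) <= kap * (Num.sqrt s%:R * M + norm1 u / Num.sqrt s%:R).
Proof.
have s0 : 0 < Num.sqrt (s%:R : R) by rewrite sqrtr_gt0 ltr0n.
have s2 : Num.sqrt (s%:R : R) ^+ 2 = s%:R by rewrite sqr_sqrtr // ler0n.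
have kap0 : 0 <= kap by exact: sqrtr_ge0.
have [N] := ubnP #|supp u|; elim: N => // N IHN in u M *; rewrite ltnS => cu uM M0.
have head (A : {set 'I_n}) : (#|A| <= s)%N ->
    norm2 (Z *m restr A u) <= kap * (Num.sqrt s%:R * M).
  move=> cA; apply: le_trans (rip_norm2 ripZ delta_ge0 _) _.
    exact: leq_trans (subset_leq_card (supp_restr A u)) cA.
  rewrite ler_wpM2l //.
  rewrite -(@ler_pXn2r _ 2) ?nnegrE ?norm2_ge0 ?mulr_ge0 ?(ltW s0) //.
  rewrite exprMn s2 sqr_norm2_restr.
  apply: (@le_trans _ _ (\sum_(i in A) M ^+ 2)).
    apply: ler_sum => i _; rewrite -real_normK ?num_real //.
    by rewrite ler_pXn2r ?nnegrE.
  by rewrite sumr_const -[leLHS]mulr_natl ler_wpM2r ?sqr_ge0 // ler_nat.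
have [cus|cus] := leqP #|supp u| s.
  rewrite -{1}(restr_id (subxx (supp u))); apply: le_trans (head _ cus) _.
  by rewrite ler_wpM2l // lerDl divr_ge0 ?(ltW s0) // sumr_ge0.
have sn : (s <= n)%N.
  by apply: leq_trans (ltnW cus) _; rewrite -[leqRHS]card_ord max_card.
have [A [cA topA]] := exists_largest u sn.
rewrite (norm1_split A u) {1}(restr_split A u) mulmxDr.
set w := restr (~: A) u.
have wM := largest_tail_le sn (conj cA topA).
rewrite (minn_idPl sn) in cA.
(* A nonzero entry inside [A] makes the support of the remainder strictly smaller, as the induction
   requires. *)
have [a aA ua0] : exists2 a, a \in A & u a 0 != 0.
  have [/exists_inP[a aA a0]|/exists_inPn h] := boolP [exists a in A, u a 0 != 0].
    by exists a.
  have uz : supp u \subset A.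
    apply/suppP => i iA; have [a aA] : exists a, a \in A.
      by apply/set0Pn; rewrite -card_gt0 cA.
    have := topA _ _ aA iA; have := h _ aA; rewrite negbK => /eqP ->.
    by rewrite normr0 normr_le0 => /eqP.
  by have := subset_leq_card uz; rewrite cA; lia.
have cw : (#|supp w| < N)%N.
  apply: leq_trans (_ : (#|supp u| <= N)%N) => //; apply: proper_card.
  apply/properP; split; first exact: supp_restr_sub.
  by exists a; [rewrite inE | rewrite inE mxE inE aA eqxx].
have w0 : 0 <= norm1 (restr A u) / s%:R by rewrite divr_ge0 ?ler0n // sumr_ge0.
have := IHN w _ cw wM w0.
(* The remainder has entries at most the mean over [A]; its entrywise term thus becomes the l1 norm
   over [A] divided by sqrt s, and completes the l1 norm of [u]. *)
have -> : Num.sqrt s%:R * (norm1 (restr A u) / s%:R) =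
    norm1 (restr A u) / Num.sqrt s%:R.
  by rewrite -{2}s2; field; rewrite gt_eqF.
have cA' : (#|A| <= s)%N by rewrite cA.
move=> hw; have hA := head _ cA'.
by apply: le_trans (norm2D _ _) _; rewrite -/w; nra.
Qed.

(** The block of the s largest entries is bounded by its l2 norm. All later blocks go to
    [rip_norm1], whose entrywise term is charged to the l1 norm of the first block, so the l1
    contributions add up to the l1 norm of [u]. *)
Lemma rip_energy (u : 'cV[R]_n) : norm2 (Z *m u) <= kap * (norm2 u + norm1 u / Num.sqrt s%:R).
Proof.
have s0 : 0 < Num.sqrt (s%:R : R) by rewrite sqrtr_gt0 ltr0n.
have s2 : Num.sqrt (s%:R : R) ^+ 2 = s%:R by rewrite sqr_sqrtr // ler0n.
have kap0 : 0 <= kap by exact: sqrtr_ge0.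
have [ns|sn] := ltnP n s.
  apply: le_trans (rip_norm2 ripZ delta_ge0 _) _.
    by apply: leq_trans (ltnW ns); rewrite -[leqRHS]card_ord max_card.
  by rewrite ler_wpM2l // lerDl divr_ge0 ?(ltW s0) // sumr_ge0.
have [A [cA topA]] := exists_largest u sn.
rewrite {1}(restr_split A u) mulmxDr; apply: le_trans (norm2D _ _) _.
set w := restr (~: A) u.
have wM := largest_tail_le sn (conj cA topA).
rewrite (minn_idPl sn) in cA.
have w0 : 0 <= norm1 (restr A u) / s%:R by rewrite divr_ge0 ?ler0n // sumr_ge0.
have := rip_norm1 wM w0.
have -> : Num.sqrt s%:R * (norm1 (restr A u) / s%:R) =
    norm1 (restr A u) / Num.sqrt s%:R.
  by rewrite -{2}s2; field; rewrite gt_eqF.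
rewrite -mulrDl -norm1_split => hw.
have cA' : (#|supp (restr A u)| <= s)%N by rewrite -cA subset_leq_card ?supp_restr.
have hA := rip_norm2 ripZ delta_ge0 cA'; rewrite -/kap in hA.
rewrite mulrDr; apply: lerD hw; apply: le_trans hA _.
by rewrite ler_wpM2l // norm2_restr_le.
Qed.

End Energy.

(** * Compressible vectors *)

Section Tail.
Context {R : realType}.

(** This compares x^(-q) with its integral over [x - 1, x] without integrating: the ratio of the two
    powers on the right is exp ((q - 1) (ln x - ln (x - 1))), bounded below by exp y >= 1 + y and ln
    x - ln (x - 1) >= 1 / x. *)
Lemma powRN_telescope (q x : R) : 1 < q -> 1 < x ->
  (q - 1) * x `^ (- q) <= (x - 1) `^ (1 - q) - x `^ (1 - q).
Proof.
move=> q1 x1; have x0 : 0 < x by lra.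
have y0 : 0 < x - 1 by lra.
have xn0 : x != 0 by rewrite gt_eqF.
have -> : x `^ (- q) = x `^ (1 - q) / x.
  by rewrite -{3}(powRr1 (ltW x0)) -powRB ?xn0 ?implybT //; congr (_ `^ _); lra.
have hln : x^-1 <= ln x - ln (x - 1).
  have -> : ln x - ln (x - 1) = - ln (1 + - x^-1).
    have -> : 1 + - x^-1 = (x - 1) / x by field.
    by rewrite lnM ?posrE ?invr_gt0 // lnV ?posrE //; ring.
  have := @le_ln1Dx R (- x^-1); rewrite ltrN2 invf_lt1 // => /(_ x1); lra.
have -> : (x - 1) `^ (1 - q) = x `^ (1 - q) * expR ((q - 1) * (ln x - ln (x - 1))).
  rewrite /powR !gt_eqF // -expRD; congr expR; ring.
have := expR_ge1Dx ((q - 1) * (ln x - ln (x - 1))).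
have : (q - 1) * x^-1 <= (q - 1) * (ln x - ln (x - 1)) by rewrite ler_wpM2l //; lra.
move: (expR _) => e h1 h2.
have xq : 0 < x `^ (1 - q) by exact: powR_gt0.
move: (x `^ _) xq => X X0.
suff : 0 <= X * (e - 1 - (q - 1) * x^-1) by lra.
by apply: mulr_ge0; lra.
Qed.

Lemma sum_powRN_le (q : R) (s n : nat) : 1 < q -> (0 < s)%N -> (s <= n)%N ->
  \sum_(s <= j < n) (j.+1)%:R `^ (- q) <= s%:R `^ (1 - q) / (q - 1).
Proof.
move=> q1 s0 sn; have q0 : 0 < q - 1 by lra.
rewrite ler_pdivlMr // mulrC.
apply: (@le_trans _ _ (s%:R `^ (1 - q) - n%:R `^ (1 - q))); last first.
  by rewrite lerBlDr lerDl powR_ge0.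
have /= tel := telescope_sumr (fun j => (j%:R : R) `^ (1 - q)) sn.
rewrite -[leRHS]opprB -tel.
rewrite big_distrr -sumrN /=; apply: ler_sum_nat => j /andP[sj _].
have := @powRN_telescope q j.+1%:R q1.
rewrite ltr1n ltnS => /(_ (leq_trans s0 sj)).
have -> : j.+1%:R - 1 = j%:R :> R by rewrite -natr1 addrK.
by rewrite opprB.
Qed.

Context {n : nat}.
Implicit Types (g : 'cV[R]_n).

(** Sorting indices instead of values yields an actual set [S] and disposes of ties; [F] is
    arbitrary so that the same [S] serves the l2 and the l1 tail. *)
Lemma kth_largest_sum g s : (s <= n)%N ->
  exists2 S : {set 'I_n}, #|S| = s &
    forall F : R -> R, \sum_(i | i \notin S) F `|g i 0| =
      \sum_(s <= j < n) F (kth_largest g j.+1).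
Proof.
move=> sn; set leT := relpre (fun i : 'I_n => `|g i 0|) >=%R.
set r := sort leT (enum 'I_n).
have r_uniq : uniq r by rewrite sort_uniq enum_uniq.
have size_r : size r = n by rewrite size_sort size_enum_ord.
exists [set i in take s r]%SET.
  rewrite cardsE (card_uniqP _) ?take_uniq // size_take size_r.
  by case: ltngtP sn => // ->.
move=> G.
rewrite -[index_enum _]enumT -(perm_big _ (permEl (perm_sort leT _))) /= -/r.
have mem_take : forall i, i \in take s r -> i \notin drop s r.
  move=> i it; move: r_uniq; rewrite -{1}(cat_take_drop s r) cat_uniq.
  by case/and3P=> _ /hasPn h _; apply: contraL it => /h.
rewrite -{1}(cat_take_drop s r) big_cat /= big1_seq ?add0r; last first.
  by move=> i /andP[]; rewrite inE => /negbTE ->.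
rewrite big_seq_cond (eq_bigl (fun i => i \in drop s r)); last first.
  move=> i /=; rewrite inE; case: (boolP (i \in drop s r)) => //= id.
  by apply: contraL id => /mem_take.
rewrite -big_seq -(big_map (fun i => `|g i 0|) xpredT G) map_drop -sort_map.
rewrite /kth_largest; set t := sort _ _.
have size_t : size t = n by rewrite size_sort size_map size_enum_ord.
rewrite (big_nth 0) size_drop size_t -[in RHS](add0n s) big_addn.
by apply: eq_bigr => j _; rewrite nth_drop addnC.
Qed.

(** The decay hypothesis reduces the tails to sums of powers with exponents 2/p and 1/p, both above
    1 because p < 1. *)
Lemma compressible_tail g (p G : R) s : 0 < p < 1 -> 0 <= G ->
  (0 < s)%N -> (s <= n)%N ->
  (forall j, (1 <= j <= n)%N -> kth_largest g j <= G / j%:R `^ (1 / p)) ->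
  exists S : {set 'I_n}, [/\ #|S| = s,
    norm2 (restr (~: S) g) <= G * s%:R `^ (1 / 2 - 1 / p) / Num.sqrt (2 / p - 1) &
    norm1 (restr (~: S) g) / Num.sqrt s%:R <=
      G * s%:R `^ (1 / 2 - 1 / p) / (1 / p - 1)].
Proof.
move=> /andP[p0 p1] G0 s0 sn hg.
have ip1 : 1 < 1 / p by rewrite ltr_pdivlMr // mul1r.
have q2 : 1 < 2 / p by rewrite ltr_pdivlMr // mul1r; lra.
have sR : 0 < s%:R :> R by rewrite ltr0n.
have kth_ge0 j : 0 <= kth_largest g j.
  rewrite /kth_largest; set t := sort _ _.
  have [jt|jt] := ltnP j.-1 (size t); last by rewrite nth_default.
  have : nth 0 t j.-1 \in t by exact: mem_nth.
  by rewrite mem_sort => /mapP[i _ ->].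
have [S cS sumS] := kth_largest_sum g sn.
exists S; split=> //.
- set B := G * _ / _.
  have e2 : (s%:R : R) `^ (1 - 2 / p) = (s%:R `^ (1 / 2 - 1 / p)) ^+ 2.
    rewrite -powR_mulrn ?powR_ge0 // -powRrM; congr (_ `^ _).
    by field; rewrite gt_eqF.
  have B0 : 0 <= B by rewrite divr_ge0 ?mulr_ge0 ?powR_ge0 ?sqrtr_ge0.
  rewrite -(@ler_pXn2r _ 2) ?nnegrE ?norm2_ge0 //.
  rewrite sqr_norm2_restr.
  have -> : \sum_(i in ~: S) g i 0 ^+ 2 = \sum_(i | i \notin S) `|g i 0| ^+ 2.
    by apply: eq_big => i; rewrite ?inE // => _; rewrite real_normK ?num_real.
  rewrite (sumS (fun x => x ^+ 2)) /B expr_div_n exprMn sqr_sqrtr; last by lra.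
  rewrite -e2 -mulrA.
  apply: le_trans (_ : _ <= G ^+ 2 * \sum_(s <= j < n) j.+1%:R `^ (- (2 / p))) _.
    rewrite big_distrr /=; apply: ler_sum_nat => j /andP[_ jn].
    have := hg j.+1; rewrite ltnS leq0n => /(_ jn) h.
    have -> : (j.+1%:R : R) `^ (- (2 / p)) = ((j.+1%:R `^ (1 / p)) ^-1) ^+ 2.
      rewrite -powRN -powR_mulrn ?powR_ge0 // -powRrM; congr (_ `^ _).
      by field; rewrite gt_eqF.
    by rewrite -exprMn ler_pXn2r ?nnegrE ?divr_ge0 ?powR_ge0.
  by rewrite ler_wpM2l ?sqr_ge0 // sum_powRN_le.
- have ss : 0 < Num.sqrt (s%:R : R) by rewrite sqrtr_gt0.
  rewrite ler_pdivrMr //.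
  have e1 : (s%:R : R) `^ (1 - 1 / p) = s%:R `^ (1 / 2 - 1 / p) * Num.sqrt s%:R.
    rewrite -powR12_sqrt ?ler0n // -powRD ?(gt_eqF sR) ?implybT //.
    by congr (_ `^ _); field; rewrite gt_eqF.
  rewrite [norm1 _](_ : _ = \sum_(i | i \notin S) `|g i 0|); last first.
    rewrite /norm1 [RHS]big_mkcond; apply: eq_bigr => i _; rewrite mxE inE.
    by case: ifP => //; rewrite normr0.
  rewrite (sumS id) mulrAC -[G * _ * _]mulrA -e1 -mulrA.
  apply: le_trans (_ : _ <= G * \sum_(s <= j < n) j.+1%:R `^ (- (1 / p))) _.
    rewrite big_distrr /=; apply: ler_sum_nat => j /andP[_ jn].
    by rewrite powRN; apply: hg; rewrite ltnS leq0n.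
  by rewrite ler_wpM2l // sum_powRN_le.
Qed.

(** The exponent 2p / (2 - p) in s(theta, p) is the inverse of 1/p - 1/2, so raising the hypothesis
    to that power recovers the bracket. *)
Lemma s_of_tail (theta p : R) s : 0 < theta -> 0 < p < 1 ->
  s_of theta p <= s%:R ->
  s%:R `^ (1 / 2 - 1 / p) * ((66 / 5) / Num.sqrt (2 / p - 1) + 11 / (1 / p - 1))
    <= theta / 4.
Proof.
move=> t0 /andP[p0 p1] hs.
have ip1 : 1 < 1 / p by rewrite ltr_pdivlMr // mul1r.
have q2 : 1 < 2 / p by rewrite ltr_pdivlMr // mul1r; lra.
move: hs; rewrite /s_of; set A := (66 / 5) / _ + _ => hs.
have A0 : 0 < A.
  by rewrite addr_gt0 // divr_gt0 ?sqrtr_gt0 //; lra.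
have B0 : 0 < 4 / theta * A by rewrite mulr_gt0 ?divr_gt0.
have s0 : 0 < s%:R :> R by apply: lt_le_trans hs; exact: powR_gt0.
have e0 : 0 <= 1 / p - 1 / 2 by lra.
have := ge0_ler_powR e0 _ _ hs.
rewrite !nnegrE powR_ge0 ler0n => /(_ isT isT) /=.
rewrite -powRrM.
have -> : 2 * p / (2 - p) * (1 / p - 1 / 2) = 1.
  by field; rewrite !gt_eqF //; lra.
rewrite powRr1 ?(ltW B0) // => h.
rewrite -[1 / 2 - 1 / p]opprB powRN mulrC ler_pdivrMr ?powR_gt0 //.
have : theta / 4 * (4 / theta * A) <= theta / 4 * s%:R `^ (1 / p - 1 / 2).
  by rewrite ler_wpM2l // divr_ge0 // ltW.
by have -> : theta / 4 * (4 / theta * A) = A by field; rewrite gt_eqF.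
Qed.

End Tail.

(** * Smooth functions *)

Section Smooth.
Context {R : realType} {n : nat}.
Variables (f : 'cV[R]_n -> R) (L : R).
Hypothesis df : forall x, differentiable f x.
Implicit Types x v : 'cV[R]_n.

Lemma derive_nabla x v : 'D_v (f : _ -> R^o) x = dot (nabla f x) v.
Proof.
rewrite deriveE; last exact: df.
have {1}-> : v = \sum_i v i 0 *: basis_vec i.
  apply/colP => i; rewrite summxE (bigD1 i) //= big1 => [|j ji].
    by rewrite !mxE !eqxx mulr1 addr0.
  by rewrite !mxE eq_sym (negbTE ji) mulr0.
rewrite linear_sum; apply: eq_bigr => i _.
by rewrite linearZ mxE deriveE; [rewrite mulrC | exact: df].
Qed.

Lemma is_derive_line x v (t : R) :
  is_derive t 1 (fun s : R => f (x + s *: v) : R^o) (dot (nabla f (x + t *: v)) v).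
Proof.
have E : (fun h : R => h^-1 *: (((fun s : R => f (x + s *: v) : R^o) \o shift t) (h *: (1 : R^o))
      - (f (x + t *: v) : R^o))) =
    (fun h : R => h^-1 *: (((f : _ -> R^o) \o shift (x + t *: v)) (h *: v) - f (x + t *: v))).
  apply/funext => h /=; congr (_ *: (f _ - _)).
  by rewrite /shift /= scalerDl addrCA scaler1.
have dfv : derivable (f : _ -> R^o) (x + t *: v) v by apply: diff_derivable; exact: df.
split; first by rewrite /derivable E.
by rewrite -derive_nabla /derive E.
Qed.

Hypothesis lip : forall x y, norm2 (nabla f x - nabla f y) <= L * norm2 (x - y).

(** The mean value theorem is applied to the remainder along the segment, with sign [sg], minus L/2
    t^2 times the squared norm of [v]: its derivative is nonpositive by the Lipschitz bound. Both
    signs together give the absolute value. *)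
Lemma taylor_bound x v :
  `|f (x + v) - f x - dot (nabla f x) v| <= L / 2 * norm2 v ^+ 2.
Proof.
pose N := norm2 v ^+ 2.
have key (sg : R) : `|sg| = 1 ->
    sg * (f (x + v) - f x - dot (nabla f x) v) <= L / 2 * N.
  move=> sg1.
  pose psi (t : R) : R^o := sg * (f (x + t *: v) - t * dot (nabla f x) v)
    - L / 2 * t ^+ 2 * N.
  pose dpsi (t : R) : R := sg * (dot (nabla f (x + t *: v)) v - dot (nabla f x) v)
    - L * t * N.
  have dpsiP t : is_derive t (1 : R^o) psi (dpsi t).
    have hl := is_derive_line x v t.
    rewrite /psi; apply: is_derive_eq.
    by rewrite /dpsi /GRing.scale /=; field.
  have cpsi : {within `[0, 1], continuous psi}.
    apply: continuous_subspaceT => t.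
    apply: differentiable_continuous; apply/derivable1_diffP.
    exact: (@ex_derive _ _ _ _ _ _ _ (dpsiP t)).
  have [c /[!in_itv]/= /andP[c0 c1] ce] := MVT ltr01 (fun t _ => dpsiP t) cpsi.
  have : dpsi c <= 0.
    rewrite /dpsi subr_le0 -dotNl -dotDl.
    apply: le_trans (ler_norm _) _; rewrite normrM sg1 mul1r.
    apply: le_trans (norm_dot_le _ _) _.
    rewrite /N expr2 mulrA ler_wpM2r ?norm2_ge0 //.
    apply: le_trans (lip _ _) _; rewrite addrAC subrr add0r norm2Z gtr0_norm //.
    by rewrite mulrA.
  move: ce; rewrite subr0 mulr1 => <-.
  rewrite /psi scale1r scale0r addr0 mul0r subr0 expr0n /= expr1n mulr0 mul0r mul1r.
  by lra.
rewrite ler_norml; apply/andP; split.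
  by have := key (-1); rewrite normrN1 => /(_ erefl); rewrite -/N; lra.
by have := key 1; rewrite normr1 => /(_ erefl); rewrite -/N; lra.
Qed.

End Smooth.

(** * Accuracy of the compressed gradient estimate *)

Lemma le_absz_ceil {R : realType} (x : R) : x <= (`|Num.ceil x|%N)%:R.
Proof. by rewrite natr_absz; apply: le_trans (ceil_ge x) _; rewrite ler_int ler_norm. Qed.

Lemma absz_ceil_lt {R : realType} (x : R) : 0 <= x -> (`|Num.ceil x|%N)%:R < x + 1.
Proof.
move=> x0; rewrite natr_absz ger0_norm.
  by have /andP[h _] := ceil_itv x; move: h; rewrite intrB; lra.
by rewrite ceil_ge0; lra.
Qed.

Definition sensing {R : realType} m n (mn : (m <= n)%N) (z : 'M[R]_n) : 'M[R]_(m, n) :=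
  \matrix_(i < m, l < n) (z (widen_ord mn i) l / Num.sqrt m%:R).

Lemma rip_mono {R : realType} m n (Z : 'M[R]_(m, n)) k k' (delta : R) :
  (k <= k')%N -> rip Z k' delta -> rip Z k delta.
Proof. by move=> kk' h x cx; apply: h; exact: leq_trans cx kk'. Qed.

Lemma sqrt_rip_constant {R : realType} (delta : R) : 0 <= delta -> delta <= 5 / 22 ->
  Num.sqrt (1 + delta) ^+ 2 <= 27 / 22 /\ Num.sqrt (1 + delta) <= 10 / 9.
Proof.
move=> d0 d1; have d2 : 0 <= 1 + delta by exact: addr_ge0.
have k2 : Num.sqrt (1 + delta) ^+ 2 <= 27 / 22 by rewrite (sqr_sqrtr d2); lra.
split=> //; rewrite -(@ler_pXn2r _ 2) ?nnegrE ?sqrtr_ge0 //.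
by apply: le_trans k2 _; rewrite expr2; lra.
Qed.

(* The constants of s(theta, p) and of h_j enter through 1 + 8 k^2 <= 66 / 5,
   8 k^2 <= 11 and 8 k / 22 <= 1 / 2. *)
Lemma error_budget {R : realFieldType} (a c k E X G theta eps : R) :
  0 <= k -> k ^+ 2 <= 27 / 22 -> k <= 10 / 9 -> 0 <= a -> 0 <= c ->
  0 <= theta -> 0 <= eps -> eps <= G ->
  E <= k * (a + c) + theta * eps / 22 -> 66 / 5 * a + 11 * c <= theta / 4 * G ->
  X <= theta / 4 * G -> a + (X + 8 * (k * E)) <= theta * G.
Proof.
move=> k0 k2 k1 a0 c0 t0 e0 eG hE tail hX.
have kE : k * E <= 27 / 22 * (a + c) + 10 / 9 * (theta * eps / 22).
  apply: le_trans (ler_wpM2l k0 hE) _; rewrite mulrDr mulrA -expr2.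
  apply: lerD; first by rewrite ler_wpM2r // addr_ge0.
  by rewrite ler_wpM2r // divr_ge0 // mulr_ge0.
have te : theta * eps <= theta * G by rewrite ler_wpM2l.
by lra.
Qed.

Section Accuracy.
Context {R : realType} {n : nat}.
Variables (f : 'cV[R]_n -> R) (L eps theta b sigma0 : R) (s0 : nat).
Hypothesis df : forall x, differentiable f x.
Hypothesis L_gt0 : 0 < L.
Hypothesis lip : forall x y, norm2 (nabla f x - nabla f y) <= L * norm2 (x - y).
Hypothesis theta01 : 0 < theta < 1 / 2.
Hypothesis eps_gt0 : 0 < eps.
Hypothesis sigma0_gt0 : 0 < sigma0.

Lemma sigma_gt0 j : 0 < sigma_ sigma0 j.
Proof. by rewrite mulr_gt0 // exprn_gt0. Qed.

Lemma halving_cosamp_iters : (2 ^+ cosamp_iters theta)^-1 <= theta / 4.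
Proof.
have /andP[t0 t1] := theta01.
have t4 : 0 < theta / 4 by rewrite divr_gt0.
have h2 : (0 : R) < 1 / 2 by rewrite divr_gt0.
have l2 : ln (1 / 2 : R) < 0 by rewrite ln_lt0 // h2 /=; lra.
rewrite -ler_ln ?posrE ?invr_gt0 ?exprn_gt0 //.
have -> : (2 ^+ cosamp_iters theta)^-1 = (1 / 2) ^+ cosamp_iters theta :> R.
  by rewrite div1r exprVn.
rewrite lnXn // -[leLHS]mulr_natl -ler_ndivrMr //.
exact: le_absz_ceil.
Qed.

(** A sign vector has squared norm n, so the Taylor remainder in each entry is at most L h n / (2
    sqrt m); the sum of m squares cancels the m. *)
Lemma finite_difference_noise m (mn : (m <= n)%N) (z : 'M[R]_n) x (h : R) :
  (0 < m)%N -> 0 < h -> (forall i l, z i l = 1 \/ z i l = -1) ->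
  norm2 ((\col_(i < m) ((f (x + h *: (row (widen_ord mn i) z)^T) - f x)
      / (Num.sqrt m%:R * h))) - sensing mn z *m nabla f x) <= L * h * n%:R / 2.
Proof.
move=> m0 h0 zpm; set N := _ - _.
have mR : 0 < m%:R :> R by rewrite ltr0n.
have sm : 0 < Num.sqrt (m%:R : R) by rewrite sqrtr_gt0.
have sm2 : Num.sqrt (m%:R : R) ^+ 2 = m%:R by rewrite sqr_sqrtr // ltW.
set B := L * h * n%:R / 2.
have B0 : 0 <= B by rewrite divr_ge0 // !mulr_ge0 // ltW.
have Ni i : N i 0 ^+ 2 <= B ^+ 2 / m%:R.
  pose zi := (row (widen_ord mn i) z)^T.
  have zi2 : norm2 zi ^+ 2 = n%:R.
    rewrite sqr_norm2 /dot (eq_bigr (fun=> 1)) ?sumr_const ?card_ord // => l _.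
    by rewrite !mxE; case: (zpm (widen_ord mn i) l) => ->; rewrite ?mulrNN mulr1.
  have NE : N i 0 * (Num.sqrt m%:R * h) = f (x + h *: zi) - f x - dot (nabla f x) (h *: zi).
    rewrite !mxE -/zi mulrBl divfK ?gt_eqF ?mulr_gt0 //; congr (_ - _).
    rewrite dotZr /dot mulrA mulrC; congr (_ * _); rewrite big_distrl /=.
    by apply: eq_bigr => l _; rewrite !mxE mulrAC divfK ?gt_eqF // mulrC.
  have := taylor_bound df lip x (h *: zi).
  rewrite norm2Z exprMn zi2 real_normK ?num_real // -NE normrM.
  rewrite [X in _ * X]gtr0_norm ?mulr_gt0 // => ht.
  have ht' : `|N i 0| * Num.sqrt m%:R <= B.
    rewrite -(ler_pM2r h0) -mulrA; apply: le_trans ht _.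
    by rewrite /B le_eqVlt; apply/orP; left; apply/eqP; field.
  rewrite -real_normK ?num_real // ler_pdivlMr // -sm2 -exprMn.
  by rewrite ler_pXn2r // nnegrE (mulr_ge0 (normr_ge0 _) (ltW sm)).
rewrite -(@ler_pXn2r _ 2) ?nnegrE ?norm2_ge0 // sqr_norm2 /dot.
apply: (@le_trans _ _ (\sum_(i < m) B ^+ 2 / m%:R)).
  by apply: ler_sum => i _; rewrite -expr2.
by rewrite sumr_const card_ord -[leLHS]mulr_natr divfK // gt_eqF.
Qed.

(** The measurements are read as those of the head of the gradient, which is s-sparse, with noise
    [e] made of the measured tail [Z *m w] and the finite difference error. The error of [g] is then
    the tail, the unfinished CoSaMP contraction, and 8 E. *)
Lemma compressed_accuracy (p : R) (z : 'M[R]_n) x j (mn : (m_ n b s0 j < n)%N)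
    (g : 'cV[R]_n) (delta : R) :
  0 < p < 1 ->
  (forall i : nat, (1 <= i <= n)%N ->
    kth_largest (nabla f x) i <= norm2 (nabla f x) / (i%:R `^ (1 / p))) ->
  (forall i l, z i l = 1 \/ z i l = -1) ->
  (0 < m_ n b s0 j)%N -> (0 < s_ s0 j)%N -> (s_ s0 j <= n)%N ->
  s_of theta p <= (s_ s0 j)%:R ->
  0 <= delta <= 5 / 22 ->
  rip (sensing (ltnW mn) z) (4 * s_ s0 j) delta ->
  L <= sigma_ sigma0 j ->
  eps <= norm2 (nabla f x) ->
  compressed_estimate f eps theta sigma0 z x mn g ->
  norm2 (nabla f x - g) <= theta * norm2 (nabla f x).
Proof.
move=> p01 decay zpm m0 s0' sn hs /andP[d0 d1] ripZ hL heps.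
have /andP[t0 t1] := theta01; have sg := sigma_gt0 j.
set m := m_ n b s0 j in mn m0 ripZ *; set s := s_ s0 j in s0' sn hs ripZ *.
set sigma := sigma_ sigma0 j in hL sg *.
rewrite /compressed_estimate -/sigma -/m -/s.
set h := theta / _ * eps.
have n0 : 0 < n%:R :> R by rewrite ltr0n; exact: leq_trans s0' sn.
have h0 : 0 < h by rewrite mulr_gt0 // divr_gt0 // !mulr_gt0.
set Z := \matrix_(i, l) _; set y := \col_i _ => hg.
have ZE : Z = sensing (ltnW mn) z by [].
set G := norm2 (nabla f x) in heps decay *.
have G0 : 0 <= G by exact: norm2_ge0.
have [S [cS t2 t1']] := compressible_tail p01 G0 s0' sn decay.
set w := restr (~: S) (nabla f x) in t2 t1'.
set e := Z *m w + (y - Z *m nabla f x).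
have yE : y = Z *m restr S (nabla f x) + e.
  by rewrite /e addrA -mulmxDr -restr_split addrC subrK.
have cx : (#|supp (restr S (nabla f x))| <= s)%N.
  by rewrite -cS subset_leq_card ?supp_restr.
rewrite yE in hg; rewrite -ZE in ripZ.
have [_ hg2] := cosamp_bound ripZ d0 cx d1 hg.
have noise : norm2 (y - Z *m nabla f x) <= L * h * n%:R / 2.
  exact: finite_difference_noise.
(* The factor 11 n sigma in the denominator of [h] is made for this bound, given L <= sigma. *)
have noise' : L * h * n%:R / 2 <= theta * eps / 22.
  have -> : L * h * n%:R / 2 = theta * eps / 22 * (L / sigma).
    by rewrite /h; field; rewrite !gt_eqF.
  rewrite ler_piMr ?ler_pdivrMr ?mul1r //.
  by rewrite divr_ge0 // mulr_ge0 // ltW.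
have ripZs : rip Z s delta by apply: rip_mono ripZ; rewrite leq_pmull.
have energy := rip_energy ripZs d0 s0' w.
set kap := Num.sqrt (1 + delta) in hg2 energy.
have kap0 : 0 <= kap by exact: sqrtr_ge0.
have [kap2 kap1] := sqrt_rip_constant d0 d1; rewrite -/kap in kap2 kap1.
set a := norm2 w in t2 energy *; set c := norm1 w / _ in t1' energy.
have a0 : 0 <= a by exact: norm2_ge0.
have c0 : 0 <= c by rewrite divr_ge0 ?sqrtr_ge0 // sumr_ge0.
have he : norm2 e <= kap * (a + c) + theta * eps / 22.
  by apply: le_trans (norm2D _ _) (lerD energy (le_trans noise noise')).
have tail : 66 / 5 * a + 11 * c <= theta / 4 * G.
  have := s_of_tail t0 p01 hs.
  set P := s%:R `^ _ in t2 t1' *; set u := Num.sqrt _ in t2 *; set v := 1 / p - 1 in t1' *.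
  move=> hP; apply: le_trans (_ : G * (P * (66 / 5 / u + 11 / v)) <= _).
    have -> : G * (P * (66 / 5 / u + 11 / v)) = 66 / 5 * (G * P / u) + 11 * (G * P / v) by ring.
    by apply: lerD; rewrite ler_wpM2l // divr_ge0.
  by rewrite mulrC ler_wpM2r.
have hx : norm2 (restr S (nabla f x)) / 2 ^+ cosamp_iters theta <= theta / 4 * G.
  rewrite mulrC; apply: ler_pM; rewrite ?norm2_ge0 ?invr_ge0 ?exprn_ge0 //.
    exact: halving_cosamp_iters.
  exact: norm2_restr_le.
have -> : nabla f x - g = w + (restr S (nabla f x) - g).
  by rewrite {1}(restr_split S (nabla f x)) -/w addrAC addrC.
apply: le_trans (norm2D _ _) _; rewrite -/a.
apply: le_trans (lerD (lexx a) hg2) _.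
by apply: error_budget he tail hx => //; exact: ltW.
Qed.

(* With [‖g - nabla f‖ <= theta ‖nabla f‖], the quadratic upper model at
   [x - g / sigma] is at most [f x - ‖nabla f‖^2 / (2 sigma)] as soon as
   [(1 + theta)^2 L <= (1 - 2 theta) sigma]. *)
Lemma accurate_accepted (x : 'cV[R]_n) j (g : 'cV[R]_n) :
  (theta + 1) ^+ 2 / (1 - 2 * theta) * L <= sigma_ sigma0 j ->
  eps <= norm2 (nabla f x) ->
  norm2 (nabla f x - g) <= theta * norm2 (nabla f x) ->
  accepted f eps sigma0 x j g.
Proof.
move=> hs heps hg; have sg := sigma_gt0 j; have /andP[t0 t1] := theta01.
rewrite /accepted /trial; set sigma := sigma_ sigma0 j in hs sg *.
set G := norm2 _ in heps hg *.
have t12 : 0 < 1 - 2 * theta by lra.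
have := taylor_bound df lip x (- (sigma^-1 *: g)).
rewrite ler_norml => /andP[_].
rewrite dotNr dotZr norm2N norm2Z exprMn real_normK ?num_real // => ht.
have hd : (1 - theta) * G ^+ 2 <= dot (nabla f x) g.
  have := dot_le_norm2 (nabla f x) (nabla f x - g).
  rewrite dotDr dotNr -sqr_norm2 -/G => h.
  have : G * norm2 (nabla f x - g) <= G * (theta * G) by rewrite ler_wpM2l ?norm2_ge0.
  by lra.
have hn : norm2 g <= (1 + theta) * G.
  have -> : g = nabla f x - (nabla f x - g) by rewrite subKr.
  by apply: le_trans (norm2B _ _) _; rewrite mulrDl mul1r lerD2l.
have hn2 : norm2 g ^+ 2 <= (1 + theta) ^+ 2 * G ^+ 2.
  rewrite -exprMn ler_pXn2r ?nnegrE ?norm2_ge0 ?mulr_ge0 ?norm2_ge0 //.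
  by lra.
have hL : L * ((1 + theta) ^+ 2 * G ^+ 2) <= (1 - 2 * theta) * sigma * G ^+ 2.
  rewrite mulrA ler_wpM2r ?sqr_ge0 //.
  have := ler_wpM2l (ltW t12) hs.
  have -> // : (1 - 2 * theta) * ((theta + 1) ^+ 2 / (1 - 2 * theta) * L) = L * (1 + theta) ^+ 2.
  by field; rewrite gt_eqF.
have hLg : L * norm2 g ^+ 2 <= (1 - 2 * theta) * sigma * G ^+ 2.
  by apply: le_trans hL; rewrite ler_wpM2l // ltW.
have heps2 : eps ^+ 2 <= G ^+ 2 by rewrite ler_pXn2r ?nnegrE ?norm2_ge0 ?(ltW eps_gt0).
have q1 : sigma^-1 * ((1 - theta) * G ^+ 2) <= sigma^-1 * dot (nabla f x) g.
  by rewrite ler_wpM2l // invr_ge0 ltW.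
have q2 : L / 2 * (sigma^-1 ^+ 2 * norm2 g ^+ 2) <= sigma^-1 / 2 * ((1 - 2 * theta) * G ^+ 2).
  have -> : L / 2 * (sigma^-1 ^+ 2 * norm2 g ^+ 2) = sigma^-1 ^+ 2 / 2 * (L * norm2 g ^+ 2) by ring.
  have -> : sigma^-1 / 2 * ((1 - 2 * theta) * G ^+ 2) =
      sigma^-1 ^+ 2 / 2 * ((1 - 2 * theta) * sigma * G ^+ 2).
    by field; rewrite gt_eqF.
  by rewrite ler_wpM2l // divr_ge0 ?sqr_ge0.
have q3 : (2 * sigma)^-1 * eps ^+ 2 <= sigma^-1 / 2 * G ^+ 2.
  by rewrite invfM mulrC [2^-1 * _]mulrC mulrC ler_wpM2l // divr_ge0 // invr_ge0 ltW.
by lra.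
Qed.

End Accuracy.

(** * A net of the sparse unit ball *)

Section Net.
Context {R : realType} {n M : nat}.

(** A signed integer: zero has a single code, and [a] stands for the magnitude a + 1. The type is
    finite, so vectors of codes can be counted entry by entry. *)
Definition code := (unit + bool * 'I_M.+1)%type.

Definition code_weight (o : code) : nat := if o is inr (_, a) then a.+1 else 0.

Definition code_val (o : code) : R :=
  if o is inr (c, a) then (if c then 1 else -1) * a.+1%:R else 0.

Definition net_vec (c : {ffun 'I_n -> code}) : 'cV[R]_n := \col_i code_val (c i).

Definition sparse_net (k : nat) : {set {ffun 'I_n -> code}} :=
  [set c : {ffun 'I_n -> code} | (\sum_i (0 < code_weight (c i)) <= k)%N &&
    (\sum_i code_weight (c i) <= M)%N]%SET.

(* Exponential Markov bound for counting, with fugacities u for the support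
   and t for the weight. *)
Lemma card_sparse_net_le (k : nat) (u t : R) : 0 < u <= 1 -> 0 < t < 1 ->
  #|sparse_net k|%:R <= (1 + 2 * u * t / (1 - t)) ^+ n / (u ^+ k * t ^+ M).
Proof.
move=> /andP[u0 u1] /andP[t0 t1].
pose phi (o : code) : R := u ^+ (0 < code_weight o)%N * t ^+ code_weight o.
have phi0 o : 0 <= phi o by rewrite mulr_ge0 ?exprn_ge0 // ltW.
rewrite ler_pdivlMr ?mulr_gt0 ?exprn_gt0 //.
have -> : #|sparse_net k|%:R * (u ^+ k * t ^+ M) = \sum_(c in sparse_net k) u ^+ k * t ^+ M.
  by rewrite sumr_const mulr_natl.
apply: (@le_trans _ _ (\sum_(c : {ffun 'I_n -> code}) \prod_i phi (c i))).
  rewrite [leRHS](bigID (mem (sparse_net k))) /= -[leLHS]addr0.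
  apply: lerD; last by apply: sumr_ge0 => c _; apply: prodr_ge0.
  apply: ler_sum => c; rewrite inE => /andP[ck cM].
  rewrite big_split /= !prodrXr; apply: ler_pM; rewrite ?exprn_ge0 ?(ltW u0) ?(ltW t0) //.
    by rewrite ler_wiXn2l // ltW.
  by rewrite ler_wiXn2l // ltW.
rewrite -(bigA_distr_bigA (fun=> phi)) prodr_const card_ord.
apply: lerXn2r; rewrite ?nnegrE ?sumr_ge0 //.
  by rewrite addr_ge0 // divr_ge0 ?mulr_ge0 ?(ltW u0) ?(ltW t0) // subr_ge0 ltW.
rewrite (big_sumType _ xpredT phi) /= (bigD1 tt) //= big1 => [|[] //].
rewrite addr0 {1}/phi /= expr0 mulr1 lerD2l.
have -> : \sum_(p : bool * 'I_M.+1) phi (inr p) =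
    \sum_(c : bool) \sum_(a < M.+1) u * t ^+ a.+1.
  by rewrite pair_bigA; apply: eq_bigr => [[c a] _]; rewrite /phi /= expr1.
rewrite big_bool /= -mulr2n -big_distrr /= -[leLHS]mulr_natl -!mulrA.
rewrite ler_pM2l // ler_pM2l //.
under eq_bigr do rewrite exprS.
rewrite -big_distrr /= ler_pM2l // -[leRHS]mul1r ler_pdivlMr ?subr_gt0 // -opprB mulrN mulrC.
by rewrite -subrX1 opprB lerBlDr lerDl exprn_ge0 // ltW.
Qed.

End Net.

Section Rounding.
Context {R : realType} {n : nat}.
Implicit Types x : 'cV[R]_n.

Lemma norm1_le_sqrt k x : (#|supp x| <= k)%N -> norm1 x <= Num.sqrt k%:R * norm2 x.
Proof.
move=> cx; rewrite -(@ler_pXn2r _ 2) ?nnegrE ?mulr_ge0 ?sqrtr_ge0 ?norm2_ge0 ?sumr_ge0 //.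
rewrite exprMn sqr_sqrtr ?ler0n //.
pose ax : 'cV[R]_n := \col_i `|x i 0|.
pose o : 'cV[R]_n := \col_i (if i \in supp x then 1 else 0).
have -> : norm1 x = dot ax o.
  apply: eq_bigr => i _; rewrite !mxE inE; case: eqVneq => [->|]; rewrite ?mulr1 //.
  by rewrite normr0 mul0r.
have ax2 : norm2 ax ^+ 2 = norm2 x ^+ 2.
  rewrite !sqr_norm2; apply: eq_bigr => i _; rewrite !mxE -!expr2.
  by rewrite real_normK ?num_real.
have o2 : norm2 o ^+ 2 <= k%:R.
  rewrite sqr_norm2 (_ : dot o o = #|supp x|%:R) ?ler_nat //.
  rewrite -sumr_const [RHS]big_mkcond; apply: eq_bigr => i _; rewrite !mxE.
  by case: ifP => _; rewrite ?mulr1 ?mulr0.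
have d0 : 0 <= dot ax o.
  by apply: sumr_ge0 => i _; rewrite !mxE; case: ifP; rewrite ?mulr1 ?mulr0.
apply: le_trans (_ : (norm2 ax * norm2 o) ^+ 2 <= _).
  by rewrite ler_pXn2r ?nnegrE ?mulr_ge0 ?norm2_ge0 // dot_le_norm2.
by rewrite exprMn ax2 mulrC ler_wpM2r ?sqr_ge0.
Qed.

(* Scaling by 8 sqrt k and rounding every entry towards 0. *)
Lemma net_approx k x : (0 < k)%N -> (#|supp x| <= k)%N -> norm2 x = 1 ->
  exists c : {ffun 'I_n -> code (M := 8 * k)},
    let y : 'cV[R]_n := (8 * Num.sqrt k%:R)^-1 *: net_vec c in
    [/\ c \in sparse_net k, supp y \subset supp x,
        norm2 (x - y) <= 1 / 8 & norm2 y <= 1].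
Proof.
(* The l1 norm of [x] is at most sqrt k, so the rounded vector has weight at most tau sqrt k = 8
   k. *)
move=> k0 cx x1; set tau := 8 * Num.sqrt k%:R.
have sk : 0 < Num.sqrt (k%:R : R) by rewrite sqrtr_gt0 ltr0n.
have sk2 : Num.sqrt (k%:R : R) ^+ 2 = k%:R by rewrite sqr_sqrtr ?ler0n.
have tau0 : 0 < tau by rewrite mulr_gt0.
pose r i := Num.truncn (tau * `|x i 0|).
have r_le i : (r i)%:R <= tau * `|x i 0| by rewrite truncn_le mulr_ge0 // ltW.
have r_gt i : tau * `|x i 0| < (r i).+1%:R by exact: truncnS_gt.
have sum_r : (\sum_i r i <= 8 * k)%N.
  rewrite -(ler_nat R) natr_sum; apply: le_trans (_ : tau * norm1 x <= _).
    by rewrite /norm1 big_distrr; apply: ler_sum.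
  apply: le_trans (ler_wpM2l (ltW tau0) (norm1_le_sqrt cx)) _.
  by rewrite x1 mulr1 /tau -mulrA -expr2 sk2 natrM.
have r_lt i : (r i <= 8 * k)%N.
  by apply: leq_trans sum_r; rewrite (bigD1 i) //= leq_addr.
pose c : {ffun 'I_n -> code (M := 8 * k)} :=
  [ffun i => if r i == 0%N then inl tt else inr (0 <= x i 0, inord (r i).-1)].
have wc i : code_weight (c i) = r i.
  rewrite ffunE; case: eqVneq => [->//|r0] /=.
  by rewrite inordK ?prednK ?lt0n //; have := r_lt i; lia.
have vc i : code_val (R := R) (c i) = (if 0 <= x i 0 then 1 else -1) * (r i)%:R.
  rewrite ffunE; case: eqVneq => [->/=|r0] /=; first by rewrite mulr0.
  by rewrite inordK ?prednK ?lt0n //; have := r_lt i; lia.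
have xE i : x i 0 = (if 0 <= x i 0 then 1 else -1) * `|x i 0|.
  case: lerP => h; first by rewrite mul1r ger0_norm.
  by rewrite mulN1r ltr0_norm // opprK.
have r0 i : x i 0 = 0 -> r i = 0%N.
  by move=> xi; rewrite /r xi normr0 mulr0 truncn0.
have sgn2 i : (if 0 <= x i 0 then 1 else -1 : R) ^+ 2 = 1.
  by case: ifP => _; rewrite ?expr1n ?sqrrN ?expr1n.
set y := tau^-1 *: net_vec c.
have yE i : y i 0 = (if 0 <= x i 0 then 1 else -1) * ((r i)%:R / tau).
  by rewrite !mxE vc mulrC mulrA.
exists c; split=> //.
- rewrite inE; apply/andP; split; last by under eq_bigr do rewrite wc.
  apply: leq_trans cx; rewrite -sum1_card [leqRHS]big_mkcond; apply: leq_sum => i _.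
  rewrite wc inE; case: eqVneq => [/r0 -> //|_]; exact: leq_b1.
- by apply/suppP => i; rewrite inE negbK => /eqP/r0 ri; rewrite yE ri mul0r mulr0.
(* Rounding moves only the entries of the support, each by at most 1 / tau; the total k / tau^2 is
   1/64. *)
- have entry i : (x i 0 - y i 0) ^+ 2 <= if i \in supp x then (tau^-1) ^+ 2 else 0.
    rewrite inE; case: (eqVneq (x i 0) 0) => /= xi.
      by rewrite yE (r0 i xi) xi mul0r mulr0 subr0 expr0n.
    rewrite yE {1}xE -mulrBr exprMn sgn2 mul1r.
    have h1 : (r i)%:R / tau <= `|x i 0| by rewrite ler_pdivrMr // mulrC.
    have h2 : `|x i 0| - (r i)%:R / tau <= tau^-1.
      rewrite lerBlDr -[X in X + _]mul1r -mulrDl ler_pdivlMr // mulrC.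
      by rewrite nat1r ltW.
    by rewrite ler_pXn2r ?nnegrE ?subr_ge0 ?invr_ge0 // ltW.
  rewrite -(@ler_pXn2r _ 2) ?nnegrE ?norm2_ge0 ?divr_ge0 //.
  rewrite sqr_norm2 /dot; apply: le_trans (_ : \sum_i (x i 0 - y i 0) ^+ 2 <= _).
    by apply: ler_sum => i _; rewrite !mxE expr2.
  apply: le_trans (ler_sum _ (fun i _ => entry i)) _.
  rewrite -big_mkcond sumr_const -[leLHS]mulr_natr.
  apply: le_trans (_ : (tau^-1) ^+ 2 * k%:R <= _).
    by rewrite ler_wpM2l ?sqr_ge0 // ler_nat.
  rewrite -sk2 /tau invfM exprMn -mulrA -exprMn mulVf ?gt_eqF // expr1n mulr1.
  by rewrite div1r.
- rewrite -x1 -ler_sqr_norm2 !sqr_norm2; apply: ler_sum => i _.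
  rewrite -!expr2 yE exprMn sgn2 mul1r -[leRHS]real_normK ?num_real //.
  by rewrite ler_pXn2r ?nnegrE ?divr_ge0 ?(ltW tau0) // ler_pdivrMr // mulrC.
Qed.

End Rounding.

(** * From the net to all sparse vectors *)

Section RipFromNet.
Context {R : realType} {m n : nat}.
Variables (Z : 'M[R]_(m, n)) (k : nat) (delta : R).
Hypothesis k_gt0 : (0 < k)%N.
Hypothesis delta_ge0 : 0 <= delta.
Hypothesis net_rip : forall c : {ffun 'I_n -> code (M := 8 * k)}, c \in sparse_net k ->
  `|norm2 (Z *m net_vec c) ^+ 2 - norm2 (net_vec c : 'cV[R]_n) ^+ 2| <=
     3 / 4 * delta * norm2 (net_vec c : 'cV[R]_n) ^+ 2.

(** Any finite constant can start the improvement below; here it comes from the Frobenius norm. *)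
Lemma rip_crude : exists2 C, 0 <= C & rip Z k C.
Proof.
pose C := \sum_i norm2 (row i Z)^T ^+ 2.
have C0 : 0 <= C by apply: sumr_ge0 => i _; exact: sqr_ge0.
exists (C + 1); first by lra.
move=> x _; have hC : norm2 (Z *m x) ^+ 2 <= C * norm2 x ^+ 2.
  rewrite sqr_norm2 /dot big_distrl /=; apply: ler_sum => i _.
  have -> : (Z *m x) i 0 = dot (row i Z)^T x.
    by rewrite mxE; apply: eq_bigr => l _; rewrite !mxE.
  rewrite -expr2 -exprMn -real_normK ?num_real //.
  by rewrite ler_pXn2r ?nnegrE ?mulr_ge0 ?norm2_ge0 // norm_dot_le.
have := sqr_ge0 (norm2 x); have := sqr_ge0 (norm2 (Z *m x)).
by rewrite ler_norml => h1 h2; apply/andP; split; nra.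
Qed.

(** For a unit vector x' and its net point y, the defects of the two quadratic forms differ by the
    polarized defect at x' - y and x' + y, at most c times 1/8 times 2. It is available because the
    support of y lies in that of x', so both arguments remain k-sparse. *)
Lemma rip_improve c : 0 <= c -> rip Z k c -> rip Z k (3 / 4 * delta + c / 4).
Proof.
move=> c0 ripc x cx.
have [->|x_neq0] := eqVneq x 0; first by rewrite mulmx0 !norm2_0 expr0n subrr normr0 mulr0.
have N0 : 0 < norm2 x.
  by rewrite lt_def norm2_ge0 andbT; apply: contraNneq x_neq0 => /norm2_eq0 ->.
pose x' := (norm2 x)^-1 *: x.
have x'1 : norm2 x' = 1.
  by rewrite norm2Z gtr0_norm ?invr_gt0 // mulVf // gt_eqF.
have xE : x = norm2 x *: x' by rewrite scalerA mulfV ?gt_eqF // scale1r.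
have cx' : (#|supp x'| <= k)%N.
  exact: leq_trans (subset_leq_card (supp_scale _ _)) cx.
clearbody x'.
suff h : `|norm2 (Z *m x') ^+ 2 - norm2 x' ^+ 2| <= 3 / 4 * delta + c / 4.
  rewrite xE -scalemxAr !norm2Z !exprMn -mulrBr normrM x'1 expr1n mulr1.
  rewrite real_normK ?num_real // [X in X * _]ger0_norm ?sqr_ge0 //.
  by rewrite mulrC ler_wpM2r ?sqr_ge0 //; move: h; rewrite x'1 expr1n.
have [cd /= [cnet yx xy y1]] := net_approx k_gt0 cx' x'1.
set lam := (8 * _)^-1 in yx xy y1.
set y := lam *: net_vec cd in yx xy y1.
have hy : `|norm2 (Z *m y) ^+ 2 - norm2 y ^+ 2| <= 3 / 4 * delta.
  rewrite /y -scalemxAr !norm2Z !exprMn -mulrBr normrM ger0_norm ?sqr_ge0 //.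
  apply: le_trans (ler_wpM2l (sqr_ge0 _) (net_rip cnet)) _.
  rewrite mulrCA -exprMn -norm2Z -/y ler_piMr ?mulr_ge0 ?divr_ge0 //.
  by rewrite exprn_ile1 ?norm2_ge0.
clearbody y.
have csub : (#|supp (x' - y) :|: supp (x' + y)| <= k)%N.
  apply: leq_trans cx'; apply/subset_leq_card; rewrite finset.subUset.
  have xyx : (supp x' :|: supp y)%SET \subset supp x' by rewrite finset.subUset subxx yx.
  by rewrite (fintype.subset_trans (suppB _ _) xyx) (fintype.subset_trans (suppD _ _) xyx).
have := rip_dot ripc c0 csub.
have -> : dot (Z *m (x' - y)) (Z *m (x' + y)) - dot (x' - y) (x' + y) =
    (norm2 (Z *m x') ^+ 2 - norm2 x' ^+ 2) - (norm2 (Z *m y) ^+ 2 - norm2 y ^+ 2).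
  rewrite mulmxBr mulmxDr !dotE !sqr_norm2 (dotC y x') (dotC (Z *m y)).
  by ring.
move=> h; have xpy : norm2 (x' + y) <= 2.
  by apply: le_trans (norm2D _ _) _; rewrite x'1; lra.
have hc : c * norm2 (x' - y) * norm2 (x' + y) <= c / 4.
  have -> : c / 4 = c * (1 / 8) * 2 by field.
  by apply: ler_pM => //; rewrite ?mulr_ge0 ?norm2_ge0 // ler_wpM2l.
move: h hy; rewrite !ler_norml => /andP[h1 h2] /andP[h3 h4].
by apply/andP; split; lra.
Qed.

(** delta is the fixed point of c -> 3/4 delta + c/4, and the excess shrinks by 4 at each round.
    Iterating to the limit takes the place of a best constant. *)
Lemma rip_of_net : rip Z k delta.
Proof.
have [C C0 ripC] := rip_crude.
have it i : rip Z k (delta + C / 4 ^+ i).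
  elim: i => [|i IHi].
    move=> x cx; apply: le_trans (ripC x cx) _.
    by rewrite expr0 divr1 ler_wpM2r ?sqr_ge0 // lerDr.
  have -> : delta + C / 4 ^+ i.+1 = 3 / 4 * delta + (delta + C / 4 ^+ i) / 4.
    by rewrite exprSr invfM; field; rewrite expf_neq0.
  by apply: rip_improve IHi; rewrite addr_ge0 // divr_ge0 ?exprn_ge0.
move=> x cx; apply/ler_addgt0Pr => e e0.
set N := norm2 x ^+ 2; have N0 : 0 <= N by exact: sqr_ge0.
pose i := Num.truncn (C * N / e).
have hi : C * N / e < i.+1%:R by exact: truncnS_gt.
apply: le_trans (it i.+1 x cx) _; rewrite mulrDl lerD2l -/N.
rewrite mulrAC ler_pdivrMr ?exprn_gt0 //.
rewrite ltr_pdivrMr // in hi; apply: le_trans (ltW hi) _.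
rewrite mulrC ler_wpM2l ?(ltW e0) // -natrX ler_nat ltnW //.
exact: ltn_expl.
Qed.

End RipFromNet.

(** * Concentration of sums of random signs *)

Section Scalar.
Context {R : realType}.

(** This is tanh t <= t, in a form whose difference of sides has derivative - t (exp t - exp (-
    t)). *)
Lemma sinh_le_cosh (t : R) : 0 <= t -> expR t - expR (- t) <= t * (expR t + expR (- t)).
Proof.
move=> t0.
pose g (x : R) : R^o := (expR x - expR (- x)) - x * (expR x + expR (- x)).
pose dg (x : R) : R := - x * (expR x - expR (- x)).
have gP (x : R) : is_derive x (1 : R^o) g (dg x).
  by rewrite /g; apply: is_derive_eq; rewrite /dg /GRing.scale /=; ring.
suff : g t <= g 0.
  by rewrite /g oppr0 expR0 mul0r subrr subr0 subr_le0.
have cg : {within `[0, t], continuous g}.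
  apply: continuous_subspaceT => x; apply: differentiable_continuous.
  by apply/derivable1_diffP; exact: (@ex_derive _ _ _ _ _ _ _ (gP x)).
have [->|t_neq0] := eqVneq t 0; first by [].
have tgt : 0 < t by rewrite lt_def t_neq0.
have [c /[!in_itv]/= /andP[c0 c1] ce] := MVT tgt (fun x _ => gP x) cg.
rewrite -subr_le0 ce pmulr_lle0 ?subr_gt0 // /dg mulNr oppr_le0 mulr_ge0 ?(ltW c0) //.
by rewrite subr_ge0 ler_expR; lra.
Qed.

(** cosh t exp (- t^2 / 2) decreases on t >= 0, its derivative having the sign of sinh t - t cosh t;
    evenness covers the other half. *)
Lemma cosh_le (t : R) : expR t + expR (- t) <= 2 * expR (t ^+ 2 / 2).
Proof.
wlog t0 : t / 0 <= t.
  move=> h; have [/h //|/ltW t0] := lerP 0 t.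
  by have := h (- t); rewrite opprK sqrrN addrC oppr_ge0; exact.
pose g (x : R) : R^o := (expR x + expR (- x)) * expR (- (x ^+ 2 / 2)).
pose dg (x : R) : R :=
  ((expR x - expR (- x)) - x * (expR x + expR (- x))) * expR (- (x ^+ 2 / 2)).
have gP (x : R) : is_derive x (1 : R^o) g (dg x).
  by rewrite /g; apply: is_derive_eq; rewrite /dg /GRing.scale /=; field.
have cg : {within `[0, t], continuous g}.
  apply: continuous_subspaceT => x; apply: differentiable_continuous.
  by apply/derivable1_diffP; exact: (@ex_derive _ _ _ _ _ _ _ (gP x)).
suff : g t <= g 0.
  rewrite /g oppr0 expR0 expr0n /= mul0r oppr0 expR0 mulr1.
  by rewrite [expR (- (_ / _))]expRN ler_pdivrMr ?expR_gt0.
have [->|t_neq0] := eqVneq t 0; first by [].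
have tgt : 0 < t by rewrite lt_def t_neq0.
have [c /[!in_itv]/= /andP[c0 c1] ce] := MVT tgt (fun x _ => gP x) cg.
rewrite -subr_le0 ce pmulr_lle0 ?subr_gt0 // /dg pmulr_lle0 ?expR_gt0 //.
by rewrite subr_le0 sinh_le_cosh // ltW.
Qed.

(* [expR x >= (1 + x / 2)^2], inverted. *)
Lemma expRN_le_quadratic (x : R) : 0 <= x -> expR (- x) <= 1 - x + 3 / 4 * x ^+ 2.
Proof.
move=> x0; have h : (1 + x / 2) ^+ 2 <= expR x.
  have -> : expR x = expR (x / 2) ^+ 2 by rewrite expr2 -expRD; congr expR; field.
  by apply: lerXn2r; rewrite ?nnegrE ?expR_ge0 ?expR_ge1Dx // addr_ge0 ?divr_ge0.
rewrite expRN -[leLHS]mul1r ler_pdivrMr ?expR_gt0 //.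
have q0 : 0 <= 1 - x + 3 / 4 * x ^+ 2 by have := sqr_ge0 (x - 2 / 3); lra.
(* The product with (1 + x / 2)^2 is 1 + x^3 / 2 + 3 x^4 / 16: the coefficient 3/4 is the one that
   cancels the quadratic term. *)
apply: le_trans (ler_wpM2l q0 h).
by have := exprn_ge0 3 x0; have := exprn_ge0 4 x0; lra.
Qed.

End Scalar.

Section SignSums.
Context {R : realType}.

Definition sign (c : bool) : R := if c then 1 else -1.

Definition rsum n (x : 'I_n -> R) (w : {ffun 'I_n -> bool}) : R :=
  \sum_l sign (w l) * x l.

Definition fcons n (c : bool) (w : {ffun 'I_n -> bool}) : {ffun 'I_n.+1 -> bool} :=
  [ffun i => if unlift ord0 i is Some j then w j else c].

Lemma sum_fcons n (F : {ffun 'I_n.+1 -> bool} -> R) :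
  \sum_w F w = \sum_w (F (fcons true w) + F (fcons false w)).
Proof.
have -> : \sum_w (F (fcons true w) + F (fcons false w)) =
    \sum_(w : {ffun 'I_n -> bool}) \sum_(c : bool) F (fcons c w).
  by apply: eq_bigr => w _; rewrite big_bool.
rewrite pair_bigA /=.
rewrite (reindex (fun p : {ffun 'I_n -> bool} * bool => fcons p.2 p.1)) //=.
exists (fun w : {ffun 'I_n.+1 -> bool} => ([ffun j => w (lift ord0 j)], w ord0)).
  move=> [w c] _; congr (_, _); last by rewrite ffunE unlift_none.
  by apply/ffunP => j; rewrite !ffunE liftK.
move=> w _; apply/ffunP => i; rewrite !ffunE /=.
by case: unliftP => [j ->|->]; rewrite ?ffunE.
Qed.

Lemma rsum_fcons n (x : 'I_n.+1 -> R) c w :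
  rsum x (fcons c w) = sign c * x ord0 + rsum (fun l => x (lift ord0 l)) w.
Proof.
rewrite /rsum big_ord_recl ffunE unlift_none; congr (_ + _).
by apply: eq_bigr => l _; rewrite ffunE liftK.
Qed.

Lemma card_signs n : #|{: {ffun 'I_n -> bool}}| = (2 ^ n)%N.
Proof. by rewrite card_ffun card_bool card_ord. Qed.

Lemma sum_signs_const n (a : R) : \sum_(w : {ffun 'I_n -> bool}) a = 2 ^+ n * a.
Proof. by rewrite sumr_const card_signs -[LHS]mulr_natl natrX. Qed.

(** The offset [c] is there for the induction: it absorbs the sign that is split off. *)
Lemma rsum_moment2 n (x : 'I_n -> R) c :
  \sum_w (c + rsum x w) ^+ 2 = 2 ^+ n * (c ^+ 2 + \sum_l x l ^+ 2).
Proof.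
elim: n x c => [|n IHn] x c.
  under eq_bigr do rewrite /rsum big_ord0 addr0.
  by rewrite sum_signs_const big_ord0 addr0.
rewrite sum_fcons; under eq_bigr do rewrite !rsum_fcons !addrA /= mul1r mulN1r.
rewrite big_split /= !IHn big_ord_recl [2 ^+ n.+1]exprS /=.
by move: (\sum_(i < n) _) => v; ring.
Qed.

Lemma rsum_moment4 n (x : 'I_n -> R) c :
  \sum_w (c + rsum x w) ^+ 4 <= 2 ^+ n *
    (c ^+ 4 + 6 * c ^+ 2 * (\sum_l x l ^+ 2) + 3 * (\sum_l x l ^+ 2) ^+ 2).
Proof.
elim: n x c => [|n IHn] x c.
  under eq_bigr do rewrite /rsum big_ord0 addr0.
  by rewrite sum_signs_const big_ord0 expr0n !mulr0 !addr0.
rewrite sum_fcons; under eq_bigr do rewrite !rsum_fcons !addrA /= mul1r mulN1r.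
rewrite big_split /=; apply: le_trans (lerD (IHn _ _) (IHn _ _)) _.
rewrite big_ord_recl [2 ^+ n.+1]exprS /=; move: (\sum_(i < n) _) => v.
have h : 0 <= (2 : R) ^+ n by exact: exprn_ge0.
move: h; move: (2 ^+ n) (x ord0) => A y A0.
have -> : A * ((c + y) ^+ 4 + 6 * (c + y) ^+ 2 * v + 3 * v ^+ 2) +
   A * ((c - y) ^+ 4 + 6 * (c - y) ^+ 2 * v + 3 * v ^+ 2) =
   2 * A * (c ^+ 4 + 6 * c ^+ 2 * (y ^+ 2 + v) + 3 * (y ^+ 2 + v) ^+ 2)
   - 4 * (A * y ^+ 4) by ring.
by rewrite gerBl mulr_ge0 // mulr_ge0 // exprn_even_ge0.
Qed.

(* Induction on [n]: one sign is averaged with [cosh t <= exp (t^2 / 2)], which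
   turns [h] into [h / (1 - 2 h x^2)]. *)
Lemma rsum_exp_moment n (x : 'I_n -> R) (h c : R) :
  0 <= h -> 2 * h * (\sum_l x l ^+ 2) < 1 ->
  \sum_w expR (h * (c + rsum x w) ^+ 2) <= 2 ^+ n *
    expR (h * (c ^+ 2 + \sum_l x l ^+ 2) / (1 - 2 * h * (\sum_l x l ^+ 2))).
Proof.
elim: n x h c => [|n IHn] x h c h0.
  rewrite big_ord0 => _; under eq_bigr do rewrite /rsum big_ord0 addr0.
  by rewrite sum_signs_const mulr0 subr0 divr1 addr0.
rewrite big_ord_recl; set x0 := x ord0; set x' := fun l => x (lift ord0 l).
set v := \sum_(i < n) _ => hv.
have v0 : 0 <= v by apply: sumr_ge0 => l _; exact: sqr_ge0.
have xx0 := sqr_ge0 x0.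
have hv0 : 0 <= h * v by exact: mulr_ge0.
have hx0 : 0 <= h * x0 ^+ 2 by exact: mulr_ge0.
have d1 : 0 < 1 - 2 * h * x0 ^+ 2 by lra.
have d2 : 0 < 1 - 2 * h * (x0 ^+ 2 + v) by lra.
pose h' := h / (1 - 2 * h * x0 ^+ 2).
have h'0 : 0 <= h' by rewrite divr_ge0 // ltW.
have hh' : h * (1 + 2 * h * x0 ^+ 2) <= h'.
  rewrite /h' ler_pdivlMr //.
  have -> : h * (1 + 2 * h * x0 ^+ 2) * (1 - 2 * h * x0 ^+ 2) =
    h - h * (2 * h * x0 ^+ 2) ^+ 2 by ring.
  by rewrite gerBl mulr_ge0 // sqr_ge0.
have one C : expR (h * (C + x0) ^+ 2) + expR (h * (C - x0) ^+ 2) <=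
    2 * expR (h * x0 ^+ 2) * expR (h' * C ^+ 2).
  have -> : expR (h * (C + x0) ^+ 2) + expR (h * (C - x0) ^+ 2) =
     expR (h * (C ^+ 2 + x0 ^+ 2)) * (expR (2 * h * C * x0) + expR (- (2 * h * C * x0))).
    by rewrite mulrDr -!expRD; congr (expR _ + expR _); ring.
  apply: le_trans (ler_wpM2l (expR_ge0 _) (cosh_le _)) _.
  rewrite mulrCA -[leRHS]mulrA ler_pM2l // -!expRD ler_expR.
  have := ler_wpM2r (sqr_ge0 C) hh'.
  have -> : h * (C ^+ 2 + x0 ^+ 2) + (2 * h * C * x0) ^+ 2 / 2 =
     h * x0 ^+ 2 + h * (1 + 2 * h * x0 ^+ 2) * C ^+ 2 by field.
  by rewrite lerD2l.
rewrite sum_fcons.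
apply: le_trans (_ : \sum_w 2 * expR (h * x0 ^+ 2) * expR (h' * (c + rsum x' w) ^+ 2) <= _).
  apply: ler_sum => w _; rewrite !rsum_fcons /= mul1r mulN1r -/x0.
  by rewrite [x0 + _]addrC [- x0 + _]addrC !addrA.
rewrite -big_distrr /=.
have hv' : 2 * h' * v < 1.
  by rewrite /h' mulrA mulrAC ltr_pdivrMr //; lra.
have := IHn x' h' c h'0 hv'; rewrite -/v => IH.
apply: le_trans (ler_wpM2l _ IH) _; first by rewrite mulr_ge0 ?expR_ge0.
rewrite [2 ^+ n.+1]exprS mulrACA -expRD ler_wpM2l ?mulr_ge0 ?exprn_ge0 // ler_expR.
(* The denominators compose: (1 - 2 h x0^2) (1 - 2 h' v) = 1 - 2 h (x0^2 + v). *)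
have -> : h' * (c ^+ 2 + v) / (1 - 2 * h' * v) = h * (c ^+ 2 + v) / (1 - 2 * h * (x0 ^+ 2 + v)).
  rewrite /h'; field; rewrite !gt_eqF //; lra.
rewrite -lerBrDr -mulrBl -mulrBr ler_pdivlMr //.
have -> : c ^+ 2 + (x0 ^+ 2 + v) - (c ^+ 2 + v) = x0 ^+ 2 by ring.
by rewrite ler_piMr //; lra.
Qed.

End SignSums.

Section Chernoff.
Context {R : realType} {n : nat}.
Implicit Types (g : {ffun 'I_n -> bool} -> R).

(** Exponential Markov inequality with counting in place of probability. The rows vary
    independently, so the sum of products is a product of sums; each row beyond the first m
    contributes the bare factor 2^n. *)
Lemma card_chernoff g (m : nat) (kappa T : R) : (m <= n)%N ->
  \sum_w expR (g w) <= 2 ^+ n * expR kappa ->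
  #|[set w : {ffun 'I_n -> {ffun 'I_n -> bool}} |
       T <= \sum_(i < n | (i < m)%N) g (w i)]%SET|%:R
    <= 2 ^+ (n * n) * expR (m%:R * kappa - T).
Proof.
move=> mn hg; set A := [set w | _]%SET.
pose F (i : 'I_n) (e : {ffun 'I_n -> bool}) := if (i < m)%N then expR (g e) else 1.
have F0 i e : 0 <= F i e by rewrite /F; case: ifP => _; rewrite ?expR_ge0.
apply: (@le_trans _ _ (expR (- T) *
    \sum_(w : {ffun 'I_n -> {ffun 'I_n -> bool}}) \prod_i F i (w i))).
  rewrite big_distrr /= (bigID (mem A)) /= -[leLHS]addr0; apply: lerD; last first.
    by apply: sumr_ge0 => w _; rewrite mulr_ge0 ?expR_ge0 ?prodr_ge0.
  rewrite -sumr_const; apply: ler_sum => w; rewrite inE => hw.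
  rewrite /F -big_mkcond /= -expR_sum -expRD.
  by rewrite -[leLHS]expR0 ler_expR; lra.
rewrite -(bigA_distr_bigA F) expRD mulrA mulrC.
rewrite ler_wpM2r ?expR_ge0 //.
have -> : 2 ^+ (n * n) * expR (m%:R * kappa) =
   \prod_(i < n) (2 ^+ n * if (i < m)%N then expR kappa else 1).
  rewrite big_split /= prodr_const card_ord exprM; congr (_ * _).
  rewrite -big_mkcond /= prodr_const.
  rewrite (_ : #|_| = m) -?expRM_natl //.
  by rewrite -sum1_card /= (big_ord_narrow mn) sum1_card card_ord.
apply: ler_prod => i _; apply/andP; split; first exact: sumr_ge0.
rewrite /F; case: ifP => _ //; by rewrite sum_signs_const.
Qed.

End Chernoff.

(** * Restricted isometry of random sign matrices *)

Section RandomRip.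
Context {R : realType} {n : nat}.
Local Notation signs := {ffun 'I_n -> {ffun 'I_n -> bool}}.

Definition sign_mx (w : signs) : 'M[R]_n := \matrix_(i, l) sign (w i l).

Lemma sqr_norm2_sensing m (mn : (m <= n)%N) (w : signs) (x : 'cV[R]_n) : (0 < m)%N ->
  m%:R * norm2 (sensing mn (sign_mx w) *m x) ^+ 2 =
    \sum_(i < n | (i < m)%N) rsum (fun l => x l 0) (w i) ^+ 2.
Proof.
move=> m0; rewrite (big_ord_narrow mn) sqr_norm2 /dot big_distrr /=.
have sm : 0 < Num.sqrt (m%:R : R) by rewrite sqrtr_gt0 ltr0n.
have sm2 : Num.sqrt (m%:R : R) ^+ 2 = m%:R by rewrite sqr_sqrtr ?ler0n.
apply: eq_bigr => i _.
have -> : rsum (fun l => x l 0) (w (widen_ord mn i)) =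
    Num.sqrt m%:R * (sensing mn (sign_mx w) *m x) i 0.
  rewrite mxE big_distrr /=; apply: eq_bigr => l _; rewrite !mxE.
  by rewrite mulrA [Num.sqrt _ * _]mulrC divfK ?gt_eqF.
by rewrite exprMn sm2 expr2.
Qed.

(* Both Chernoff exponents are at most [- m c0 (delta / 2)] although the
   deviation is [3 delta / 4]: the net is fine enough to allow it, so that
   crude moment bounds suffice. *)
Lemma card_net_point_bad m (mn : (m <= n)%N) (v : 'cV[R]_n) (delta : R) :
  (0 < m)%N -> 2 / 9 <= delta <= 5 / 22 ->
  #|[set w : signs | 3 / 4 * delta * norm2 v ^+ 2 <
      `|norm2 (sensing mn (sign_mx w) *m v) ^+ 2 - norm2 v ^+ 2|]%SET|%:R
    <= 2 * (2 ^+ (n * n) * expR (- (m%:R * c0 (delta / 2)))).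
Proof.
move=> m0 /andP[d1 d2]; set B := [set w | _]%SET.
have rhs0 : 0 <= 2 * (2 ^+ (n * n) * expR (- (m%:R * c0 (delta / 2)))) :> R.
  by rewrite mulr_ge0 // mulr_ge0 ?exprn_ge0 ?expR_ge0.
have [v0|v_neq0] := eqVneq v 0.
  rewrite (_ : B = finset.set0) ?finset.cards0 //; apply/setP => w.
  by rewrite !inE v0 mulmx0 !norm2_0 expr0n /= mulr0 subrr normr0 ltxx.
have N0 : 0 < norm2 v.
  by rewrite lt_def norm2_ge0 andbT; apply: contraNneq v_neq0 => /norm2_eq0 ->.
pose x := (norm2 v)^-1 *: v.
have x1 : norm2 x = 1 by rewrite norm2Z gtr0_norm ?invr_gt0 // mulVf // gt_eqF.
have vE : v = norm2 v *: x by rewrite scalerA mulfV ?gt_eqF // scale1r.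
have mR : 0 < m%:R :> R by rewrite ltr0n.
pose a := 3 / 4 * delta.
(* This minimizes the lower-tail exponent - a h + 9/4 h^2; the minimum - a^2 / 9 is - delta^2 / 16,
   the leading term of - c0 (delta / 2). *)
pose h2 := 2 / 9 * a.
have a0 : 0 < a by rewrite /a; lra.
have h20 : 0 <= h2 by rewrite /h2; lra.
pose Q (e : {ffun 'I_n -> bool}) : R := rsum (fun l => x l 0) e.
have xs : \sum_l x l 0 ^+ 2 = 1.
  by have := sqr_norm2 x; rewrite x1 expr1n => ->; apply: eq_bigr => l _; rewrite expr2.
clearbody x.
pose U := [set w : signs | 25^-1 * (m%:R * (1 + a)) <=
  \sum_(i < n | (i < m)%N) 25^-1 * Q (w i) ^+ 2]%SET.
pose D := [set w : signs | - (h2 * (m%:R * (1 - a))) <=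
  \sum_(i < n | (i < m)%N) - (h2 * Q (w i) ^+ 2)]%SET.
have sub : B \subset (U :|: D)%SET.
  apply/fintype.subsetP => w; rewrite !inE vE -scalemxAr !norm2Z !exprMn x1 !expr1n mulr1.
  rewrite -[X in _ < `|_ - X|]mulr1 -mulrBr normrM [X in _ < X * _]ger0_norm ?sqr_ge0 //.
  rewrite -/a real_normK ?num_real // [a * _]mulrC ltr_pM2l ?exprn_gt0 //.
  set q := norm2 (_ *m x) ^+ 2 => hq.
  have mq : m%:R * q = \sum_(i < n | (i < m)%N) Q (w i) ^+ 2 by exact: sqr_norm2_sensing.
  rewrite -big_distrr /= -mq sumrN -big_distrr /= -mq lerN2.
  have [q1|q1] := lerP 1 q.
    apply/orP; left; rewrite ler_pM2l // ler_pM2l //.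
    by move: hq; rewrite ger0_norm ?subr_ge0 //; lra.
  apply/orP; right; rewrite ler_wpM2l // ler_pM2l //.
  by move: hq; rewrite ltr0_norm ?subr_lt0 //; lra.
apply: le_trans (_ : (#|U| + #|D|)%N%:R <= _).
  rewrite ler_nat; apply: leq_trans (subset_leq_card sub) _.
  by have := finset.cardsU U D; lia.
have sum_one : \sum_e Q e ^+ 2 = 2 ^+ n :> R.
  have := rsum_moment2 (fun l => x l 0) 0; rewrite xs expr0n add0r mulr1 => <-.
  by apply: eq_bigr => e _; rewrite add0r.
have cU : #|U|%:R <= 2 ^+ (n * n) * expR (- (m%:R * c0 (delta / 2))) :> R.
  (* 1/25 is a rational near the optimal parameter for these values of delta, and h / (1 - 2 h) is
     then 1/23. *)
  have mom : \sum_e expR (25^-1 * Q e ^+ 2) <= 2 ^+ n * expR (1 / 23) :> R.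
    have := @rsum_exp_moment R n (fun l => x l 0) 25^-1 0.
    rewrite xs mulr1 expr0n add0r mulr1 => /(_ _ _).
    have -> : 25^-1 / (1 - 2 / 25) = 1 / 23 :> R by field.
    under eq_bigr do rewrite add0r.
    by apply; lra.
  apply: le_trans (card_chernoff (25^-1 * (m%:R * (1 + a))) mn mom) _.
  rewrite ler_wpM2l ?exprn_ge0 // ler_expR.
  have -> : m%:R * (1 / 23) - 25^-1 * (m%:R * (1 + a)) = m%:R * (1 / 23 - (1 + a) / 25) by ring.
  rewrite -[- (m%:R * _)]mulrN ler_wpM2l ?(ltW mR) // /c0 /a.
  have : 0 <= (delta / 2) ^+ 3 by rewrite exprn_ge0 //; lra.
  have : delta * delta <= delta * (5 / 22) by rewrite ler_wpM2l //; lra.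
  by lra.
have cD : #|D|%:R <= 2 ^+ (n * n) * expR (- (m%:R * c0 (delta / 2))) :> R.
  have mom : \sum_e expR (- (h2 * Q e ^+ 2)) <= 2 ^+ n * expR (- h2 + 9 / 4 * h2 ^+ 2) :> R.
    apply: le_trans (_ : \sum_e (1 - h2 * Q e ^+ 2 + 3 / 4 * h2 ^+ 2 * Q e ^+ 4) <= _).
      apply: ler_sum => e _; have y0 : 0 <= h2 * Q e ^+ 2 by rewrite mulr_ge0 ?sqr_ge0.
      apply: le_trans (expRN_le_quadratic y0) _.
      by rewrite exprMn -exprM -[3 / 4 * _ * _]mulrA.
    rewrite !big_split /= sum_signs_const mulr1 sumrN -!big_distrr /= sum_one.
    have := rsum_moment4 (fun l => x l 0) 0; rewrite xs !expr0n /= mulr0 mul0r !add0r expr1n mulr1.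
    under eq_bigr do rewrite add0r.
    move=> h4; have h2s : 0 <= 3 / 4 * h2 ^+ 2 by rewrite mulr_ge0 ?sqr_ge0.
    have := ler_wpM2l h2s h4.
    have p2 : 0 <= (2 : R) ^+ n by exact: exprn_ge0.
    have := ler_wpM2l p2 (expR_ge1Dx (- h2 + 9 / 4 * h2 ^+ 2)).
    by rewrite -/Q; lra.
  apply: le_trans (card_chernoff (- (h2 * (m%:R * (1 - a)))) mn mom) _.
  rewrite ler_wpM2l ?exprn_ge0 // ler_expR.
  have -> : m%:R * (- h2 + 9 / 4 * h2 ^+ 2) - - (h2 * (m%:R * (1 - a))) =
    m%:R * (- (delta ^+ 2 / 16)) by rewrite /h2 /a; field.
  rewrite -[- (m%:R * _)]mulrN ler_wpM2l ?(ltW mR) // /c0.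
  have : 0 <= (delta / 2) ^+ 3 by rewrite exprn_ge0 //; lra.
  by lra.
by rewrite natrD; lra.
Qed.

Lemma card_sparse_net (k : nat) (delta : R) : (0 < k)%N -> (k <= n)%N ->
  0 < delta <= 5 / 22 ->
  #|@sparse_net n (8 * k) k|%:R <= expR (k%:R * (1 + ln (12 / delta) + ln (n%:R / k%:R))).
Proof.
move=> k0 kn /andP[d0 d1].
have kR : 0 < k%:R :> R by rewrite ltr0n.
have nR : 0 < n%:R :> R by rewrite ltr0n; exact: leq_trans kn.
have knR : k%:R <= n%:R :> R by rewrite ler_nat.
(* With t = 9/10 one has 2 u t / (1 - t) = 18 u = k / n, so the n-th power is at most exp k. What
   remains is the k-th power of 18 (10/9)^8 n / k, and 18 (10/9)^8 is below 12 / delta since delta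
   <= 5/22. *)
pose u : R := k%:R / (18 * n%:R).
have u0 : 0 < u by rewrite divr_gt0 ?mulr_gt0.
have u01 : 0 < u <= 1.
  rewrite divr_gt0 ?mulr_gt0 //= ler_pdivrMr ?mulr_gt0 // mul1r; lra.
have t01 : 0 < (9 / 10 : R) < 1 by lra.
apply: le_trans (card_sparse_net_le k u01 t01) _.
have -> : 1 + 2 * u * (9 / 10) / (1 - 9 / 10) = 1 + k%:R / n%:R.
  by rewrite /u; field; rewrite gt_eqF.
have e1 : (1 + k%:R / n%:R) ^+ n <= expR k%:R :> R.
  have -> : expR k%:R = expR (k%:R / n%:R) ^+ n :> R.
    by rewrite -expRM_natr divfK ?gt_eqF.
  apply: lerXn2r; rewrite ?nnegrE ?expR_ge0 ?expR_ge1Dx // addr_ge0 // divr_ge0 //.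
have d12 : 0 < 12 / delta by rewrite divr_gt0.
have nk : 0 < n%:R / k%:R :> R by rewrite divr_gt0.
have e2 : (u ^+ k * (9 / 10) ^+ (8 * k))^-1 <= ((12 / delta) * (n%:R / k%:R)) ^+ k.
  have b0 : 0 < u * (9 / 10) ^+ 8 by rewrite mulr_gt0 // exprn_gt0.
  rewrite exprM -exprMn -exprVn.
  apply: lerXn2r; rewrite ?nnegrE ?invr_ge0 ?(ltW b0) ?(ltW (mulr_gt0 d12 nk)) //.
  have t4 : (4 / 5 : R) ^+ 4 <= (9 / 10) ^+ 8.
    rewrite (exprM _ 2 4).
    by apply: lerXn2r; rewrite ?nnegrE ?exprn_ge0 //; lra.
  have -> : (12 / delta) * (n%:R / k%:R) = (u * (18 * delta / 12))^-1.
    by rewrite /u; field; rewrite !gt_eqF.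
  have dd0 : 0 < 18 * delta / 12 by lra.
  rewrite lef_pV2 ?posrE ?(mulr_gt0 u0 dd0) // ler_pM2l //.
  by apply: le_trans t4; lra.
have -> : k%:R * (1 + ln (12 / delta) + ln (n%:R / k%:R)) =
    k%:R + k%:R * ln (12 / delta) + k%:R * ln (n%:R / k%:R) by ring.
rewrite 2!expRD !expRM_natl lnK ?posrE // lnK ?posrE // -mulrA -exprMn.
apply: ler_pM => //.
by rewrite invr_ge0 mulr_ge0 ?exprn_ge0 // ltW.
Qed.

Lemma card_rip_fail m (mn : (m <= n)%N) k (delta : R) : (0 < m)%N -> (0 < k)%N -> (k <= n)%N ->
  2 / 9 <= delta <= 5 / 22 ->
  #|[set w : signs | ~~ `[< rip (sensing mn (sign_mx w)) k delta >]]%SET|%:R <=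
    2 ^+ (n * n) * (2 * expR (k%:R * (1 + ln (12 / delta) + ln (n%:R / k%:R))
                              - m%:R * c0 (delta / 2))).
Proof.
move=> m0 k0 kn d12; have /andP[d1 d2] := d12.
have d0 : 0 < delta by lra.
set A := [set w | _]%SET.
pose Bad (c : {ffun 'I_n -> code (M := 8 * k)}) :=
  [set w : signs | 3 / 4 * delta * norm2 (net_vec c) ^+ 2 <
    `|norm2 (sensing mn (sign_mx w) *m net_vec c) ^+ 2 - norm2 (net_vec c : 'cV[R]_n) ^+ 2|]%SET.
have sub w : w \in A -> exists2 c, c \in sparse_net k & w \in Bad c.
  rewrite inE => /asboolPn nrip; apply: contrapT => h; apply: nrip.
  apply: rip_of_net => //; first exact: ltW.
  move=> c cnet; rewrite leNgt; apply/negP => hc; apply: h.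
  by exists c => //; rewrite inE.
apply: le_trans (_ : \sum_(c in @sparse_net n (8 * k) k) #|Bad c|%:R <= _).
  rewrite -natr_sum ler_nat -sum1_card.
  under [leqRHS]eq_bigr do rewrite -sum1_card big_mkcond /=.
  rewrite exchange_big big_mkcond /=; apply: leq_sum => w _.
  case: ifP => // /sub[c cnet cB].
  by rewrite (bigD1 c) //= cB leq_addr.
apply: le_trans (ler_sum _ (fun c _ => card_net_point_bad mn (net_vec c) m0 d12)) _.
rewrite sumr_const -[leLHS]mulr_natl.
set E := expR (- _); rewrite expRD -/E.
have d05 : 0 < delta <= 5 / 22 by rewrite d0.
have := card_sparse_net k0 kn d05.
set N := #|_|%:R; set X := expR _ => hN.
have -> : 2 ^+ (n * n) * (2 * (X * E)) = X * (2 * (2 ^+ (n * n) * E)) by ring.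
by rewrite ler_wpM2r // mulr_ge0 // mulr_ge0 ?exprn_ge0 ?expR_ge0.
Qed.

End RandomRip.

(** * Uniform distribution of the sample *)

Section UniformSigns.
Context {R : realType} {d : measure_display} {Om : measurableType d}.
Variables (P : probability Om R) (n : nat) (z : 'I_n * 'I_n -> {RV P >-> R}).
Hypothesis iid_z : iid_rademacher_vectors z.
Local Notation signs := {ffun 'I_n -> {ffun 'I_n -> bool}}.

Definition sample_signs (w : Om) : signs :=
  [ffun i => [ffun l => z (i, l) w == 1]].

Lemma sample_sign_mx w : sample z w = sign_mx (sample_signs w).
Proof.
apply/matrixP => i l; rewrite !mxE !ffunE /sign.
have [[/(_ w) + _ _] _] := (iid_z.1 (i, l), tt).
by case=> ->; rewrite ?eqxx // (_ : (-1 == 1 :> R) = false) //; apply/eqP; lra.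
Qed.

Lemma sample_signs_set (s : signs) : sample_signs @^-1` [set s] =
  [set w | forall il, [set sign (s il.1 il.2)] (z il w)].
Proof.
apply/seteqP; split=> w /=.
  move=> sw [i l] /=; have := congr1 (fun M : 'M[R]_n => M i l) (sample_sign_mx w).
  by rewrite !mxE sw.
move=> h; apply/ffunP => i; apply/ffunP => l; rewrite !ffunE (h (i, l)) /= /sign.
by case: (s i l); rewrite ?eqxx //; apply/eqP; lra.
Qed.

Lemma measurable_sample_signs (s : signs) : measurable (sample_signs @^-1` [set s]).
Proof.
rewrite sample_signs_set.
have -> : [set w | forall il, [set sign (s il.1 il.2)] (z il w)] =
  \bigcap_(il in [set: 'I_n * 'I_n]) (z il @^-1` [set sign (s il.1 il.2) : R]).
  by apply/seteqP; split=> w /= h il; [move=> _; exact: h | exact: (h il I)].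
apply: fin_bigcap_measurable; first exact: finite_finset.
by move=> il _; rewrite -[X in measurable X]setTI; exact: measurable_funP.
Qed.

Lemma probability_sample_signs (s : signs) :
  P (sample_signs @^-1` [set s]) = ((1 / 2) ^+ (n * n))%:E.
Proof.
rewrite sample_signs_set (iid_z.2 (fun il => [set sign (s il.1 il.2) : R])).
  2: by move=> il; exact: measurable_set1.
rewrite (eq_bigr (fun=> (1 / 2 : R)%:E)).
  rewrite prodEFin prodr_const card_prod card_ord //.
move=> il _; have [_ h1 h2] := iid_z.1 il.
by rewrite /sign; case: (s _ _); [exact: h1 | exact: h2].
Qed.

Lemma probability_bigsetU_le (I : Type) (r : seq I) (F : I -> set Om) :
  (forall i, measurable (F i)) ->
  (P (\big[setU/classical_sets.set0]_(i <- r) F i) <= \sum_(i <- r) P (F i))%E.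
Proof.
move=> mF; elim: r => [|i r IHr]; first by rewrite !big_nil measure0.
rewrite !big_cons; apply: le_trans (measureU2 P (mF i) _) _.
  by apply: bigsetU_measurable => j _.
exact: leeD2l.
Qed.

(** The complement is a finite union of atoms of weight 2^(- n^2), whatever [Q] is. *)
Lemma probability_signs_event (Q : pred signs) :
  measurable [set w | Q (sample_signs w)] /\
  ((1 - #|[set s | ~~ Q s]%SET|%:R / 2 ^+ (n * n))%:E <= P [set w | Q (sample_signs w)])%E.
Proof.
pose r := [seq s <- enum {: signs} | ~~ Q s].
set A := [set w | _].
have AC : A = ~` (\big[setU/classical_sets.set0]_(s <- r) (sample_signs @^-1` [set s])).
  rewrite -bigcup_seq; apply/seteqP; split=> w /=.
    by move=> Qw [s /=]; rewrite mem_filter => /andP[/negP nQ _] sw; apply: nQ; rewrite -sw.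
  move=> h; apply/negPn/negP => nQ; apply: h; exists (sample_signs w) => //=.
  by rewrite mem_filter nQ mem_enum.
have mB : measurable (\big[setU/classical_sets.set0]_(s <- r) (sample_signs @^-1` [set s])).
  by apply: bigsetU_measurable => s _; exact: measurable_sample_signs.
split; first by rewrite AC; exact: measurableC.
rewrite AC probability_setC // EFinB; apply: leeB => //.
apply: le_trans (probability_bigsetU_le _ measurable_sample_signs) _.
under eq_bigr do rewrite probability_sample_signs.
rewrite sumEFin lee_fin /r big_filter big_enum_cond sumr_const -[leLHS]mulr_natl.
by rewrite cardsE div1r exprVn.
Qed.

End UniformSigns.

(** * Complexity of the algorithm *)

Section Run.
Context {R : realType} {n : nat}.
Variables (f : 'cV[R]_n -> R) (x0 : 'cV[R]_n) (flow eps theta b sigma0 : R) (s0 : nat).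
Variables (z : 'M[R]_n) (J : nat).
Variables (xs : nat -> 'cV[R]_n) (gs : nat -> nat -> 'cV[R]_n) (js : nat -> option nat).
Hypothesis eps_gt0 : 0 < eps.
Hypothesis sigma0_gt0 : 0 < sigma0.
Hypothesis f_ge : forall x, flow <= f x.
Hypothesis run : zoro_fa_run f x0 eps theta b sigma0 s0 z xs gs js.
Hypothesis acceptJ : forall k, eps < norm2 (nabla f (xs k)) ->
  accepted f eps sigma0 (xs k) J (gs k J).
Let c := (2 * sigma_ sigma0 J)^-1 * eps ^+ 2.

(** Level [J] would be accepted, so the first accepted level is at most [J]; a lower level has a
    smaller sigma and so guarantees an even larger decrease. *)
Lemma run_step k : eps < norm2 (nabla f (xs k)) ->
  (exists2 j, js k = Some j & (j <= J)%N) /\ f (xs k.+1) <= f (xs k) - c.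
Proof.
move=> /acceptJ accJ; have [_ _ /(_ k)] := run.
case: (js k) => [j [accj first_j ->]|[/(_ J) //]].
have jJ : (j <= J)%N by rewrite leqNgt; apply/negP => /first_j.
split; first by exists j.
suff cj : c <= (2 * sigma_ sigma0 j)^-1 * eps ^+ 2.
  by move: accj; rewrite /accepted => /(le_trans cj); lra.
rewrite /c ler_wpM2r ?sqr_ge0 // lef_pV2 ?posrE ?mulr_gt0 ?exprn_gt0 //.
by rewrite ler_pM2l // ler_wpM2r ?(ltW sigma0_gt0) // ler_weXn2l // ler1n.
Qed.

Lemma run_hitting : exists T, [/\ hitting_time f eps xs T,
  T%:R * c <= f x0 - flow &
  forall k, (k < T)%N -> exists2 j, js k = Some j & (j <= J)%N].
Proof.
have c0 : 0 < c.
  by rewrite mulr_gt0 ?invr_gt0 ?mulr_gt0 ?exprn_gt0.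
have decrease k : (forall i, (i < k)%N -> eps < norm2 (nabla f (xs i))) ->
    k%:R * c <= f x0 - flow.
  move=> h; suff : f (xs k) <= f x0 - k%:R * c by have := f_ge (xs k); lra.
  elim: k h => [|k IHk] h; first by have [-> _ _] := run; rewrite mul0r subr0.
  have [_ hk] := run_step (h k (ltnSn k)).
  have := IHk (fun i ik => h i (ltnW ik)).
  by rewrite -natr1; lra.
have ex : exists k, norm2 (nabla f (xs k)) <= eps.
  apply: contrapT => /forallNP h.
  have := decrease (Num.truncn ((f x0 - flow) / c)).+1.
  have := truncnS_gt ((f x0 - flow) / c); rewrite ltr_pdivrMr // => h1 h2.
  have : forall i, eps < norm2 (nabla f (xs i)) by move=> i; rewrite ltNge; apply/negP.
  by move=> h3; have := h2 (fun i _ => h3 i); rewrite leNgt h1.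
have [T hT minT] := ex_minnP ex.
have before k : (k < T)%N -> eps < norm2 (nabla f (xs k)).
  by move=> kT; rewrite ltNge; apply: contraL kT => /minT; rewrite leqNgt.
exists T; split; [by split | exact: decrease | move=> k /before hk].
by have [] := run_step hk.
Qed.

Lemma FE_le T : (forall k, (k < T)%N -> exists2 j, js k = Some j & (j <= J)%N) ->
  (FE n b s0 js T <=
    (T%:R * (1 + \sum_(i < J.+1) (minn (m_ n b s0 i) n + 1))%N%:R)%:E)%E.
Proof.
move=> h; set cost := (1 + _)%N.
apply: le_trans (_ : (\sum_(k < T) (cost%:R : R)%:E)%E <= _)%E.
  apply: lee_sum => k _; have [j -> jJ] := h k (ltn_ord k).
  rewrite /evals lee_fin ler_nat leq_add2l.
  have jJ' : (j.+1 <= J.+1)%N by [].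
  have -> : (\sum_(i < j.+1) (minn (m_ n b s0 i) n + 1))%N =
      (\sum_(i < J.+1 | (i < j.+1)%N) (minn (m_ n b s0 i) n + 1))%N.
    by rewrite (big_ord_narrow jJ').
  rewrite [leqRHS](bigID (fun i : 'I_J.+1 => (i < j.+1)%N)) /=.
  exact: leq_addr.
by rewrite sumEFin lee_fin sumr_const card_ord -[leLHS]mulr_natl.
Qed.

End Run.

Section Constants.
Context {R : realType}.

(** exp (- 1/24) >= 23/24 is squared four times, rounding down to short fractions, to reach exp (-
    2/3) >= 1/2. *)
Lemma ln2_ge : 2 / 3 <= ln 2 :> R.
Proof.
have h1 : 23 / 24 <= expR (- (1 / 24)) :> R.
  by apply: le_trans (expR_ge1Dx _); lra.
have sq (a c e : R) : 0 <= a -> 0 <= c -> c <= a ^+ 2 -> a <= expR e -> c <= expR (e *+ 2).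
  move=> a0 c0 ca ae; apply: le_trans ca _; rewrite -mulr_natl expRM_natl.
  by apply: lerXn2r; rewrite ?nnegrE ?expR_ge0.
have h2 : 459 / 500 <= expR (- (1 / 24) *+ 2) :> R by apply: sq h1; lra.
have h3 : 421 / 500 <= expR (- (1 / 24) *+ 2 *+ 2) :> R by apply: sq h2; lra.
have h4 : 177 / 250 <= expR (- (1 / 24) *+ 2 *+ 2 *+ 2) :> R by apply: sq h3; lra.
have h5 : 1 / 2 <= expR (- (1 / 24) *+ 2 *+ 2 *+ 2 *+ 2) :> R by apply: sq h4; lra.
have e : - (1 / 24) *+ 2 *+ 2 *+ 2 *+ 2 = - (2 / 3) :> R by field.
rewrite e expRN div1r lef_pV2 ?posrE ?expR_gt0 // in h5.
by rewrite -ler_expR lnK ?posrE.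
Qed.

Lemma ln_expn2 k : ln ((2 ^ k)%N%:R) = k%:R * ln 2 :> R.
Proof. by rewrite natrX lnXn // mulr_natl. Qed.

Lemma exp2_log2 (y : R) : 0 < y -> expR (log2 y * ln 2) = y.
Proof.
by move=> y0; rewrite /log2 divfK ?lnK ?posrE // gt_eqF // ; have := ln2_ge; lra.
Qed.

Lemma exp2_nat (k : nat) : expR (k%:R * ln 2) = 2 ^+ k :> R.
Proof. by rewrite expRM_natl lnK // posrE. Qed.

Lemma le_exp2 (y : R) k : 0 < y -> (y <= 2 ^+ k) = (log2 y <= k%:R).
Proof.
move=> y0; rewrite -exp2_nat -{1}(exp2_log2 y0) ler_expR ler_pM2r //.
by have := ln2_ge; lra.
Qed.

Lemma lt_exp2 (y : R) k : 0 < y -> (2 ^+ k < y) = (k%:R < log2 y).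
Proof. by move=> y0; rewrite ltNge le_exp2 // -ltNge. Qed.

(** For the last bound, J - 1 lies below one of the three terms of the maximum, so 2^J is less than
    twice 2, C or X; the sum avoids telling which. *)
Lemma jstar_spec (theta p L sigma0 C : R) s0 :
  let X := (theta + 1) ^+ 2 / (1 - 2 * theta) * (L / sigma0) in
  let J := `|jstar theta p L sigma0 s0|%N in
  (0 < s0)%N -> 0 < X -> 1 <= jstar theta p L sigma0 s0 ->
  s0%:R <= s_of theta p <= C * s0%:R ->
  [/\ jstar theta p L sigma0 s0 = J%:Z, (1 <= J)%N, s_of theta p <= 2 ^+ J * s0%:R,
      X <= 2 ^+ J & 2 ^+ J <= 4 + 2 * C + 2 * X].
Proof.
move=> X J s00 X0 j1 /andP[sl su].
have s0R : 0 < s0%:R :> R by rewrite ltr0n.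
have sof0 : 0 < s_of theta p by exact: lt_le_trans sl.
have JE : jstar theta p L sigma0 s0 = J%:Z by rewrite /J gez0_abs // (le_trans _ j1).
have J1 : (1 <= J)%N by rewrite -lez_nat -JE.
set M := Num.max 1 (Num.max (log2 (s_of theta p / s0%:R)) (log2 X)).
have Jge : M <= J%:R by rewrite pmulrn -JE; exact: ceil_ge.
have Jlt : J%:R - 1 < M.
  have /andP[h _] := ceil_itv M.
  by move: h; rewrite -/(jstar theta p L sigma0 s0) JE intrB.
have a0 : 0 < s_of theta p / s0%:R by rewrite divr_gt0.
move: Jge; rewrite !ge_max => /and3P[_ h1 h2]; split=> //.
- by rewrite -ler_pdivrMr // le_exp2.
- by rewrite le_exp2.
- have C0 : 1 <= C by rewrite -(ler_pM2r s0R) mul1r; exact: le_trans su.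
  have [k Jk] : exists k, J = k.+1 by exists J.-1; rewrite prednK.
  move: Jlt; rewrite Jk -natr1 addrK exprS !lt_max => /or3P[k1|ka|kX].
  + have -> : k = 0%N by move: k1; rewrite ltrn1; case: k {Jk}.
    rewrite expr0; lra.
  + have : 2 ^+ k < s_of theta p / s0%:R by rewrite lt_exp2.
    have : s_of theta p / s0%:R <= C by rewrite ler_pdivrMr.
    lra.
  + have : 2 ^+ k < X by rewrite lt_exp2.
    lra.
Qed.

End Constants.

(** * Sizes and costs of the levels *)

Section Levels.
Context {R : realType}.
Variables (n : nat) (b : R) (s0 J : nat).
Hypothesis b_ge1 : 1 <= b.
Hypothesis s0_gt0 : (0 < s0)%N.

Lemma le_m_ i : b * (s_ s0 i)%:R * ln n%:R <= (m_ n b s0 i)%:R.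
Proof. exact: le_absz_ceil. Qed.

Lemma s_E i : (s_ s0 i)%:R = 2 ^+ i * s0%:R :> R.
Proof. by rewrite /s_ natrM natrX. Qed.

Lemma s_gt0 i : (0 < s_ s0 i)%N.
Proof. by rewrite /s_ muln_gt0 expn_gt0. Qed.

Lemma m_lt i : (0 < n)%N -> (m_ n b s0 i)%:R < b * (s_ s0 i)%:R * ln n%:R + 1.
Proof.
move=> n0; apply: absz_ceil_lt; rewrite !mulr_ge0 ?ler0n ?(le_trans ler01 b_ge1) //.
by rewrite ln_ge0 // ler1n.
Qed.

(** The hypothesis on m_0 bootstraps itself: ln n <= m_0 <= n / 4, so n >= 2 gives m_0 >= 1 and n >=
    4, whence m_0 >= 2, n >= 8 and ln n >= 2. *)
Lemma level_bounds : (2 <= n)%N -> (m_ n b s0 0)%:R <= n%:R / 4 :> R ->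
  J%:Z < J_of n b s0 - 1 ->
  [/\ (m_ n b s0 J < n)%N, (0 < m_ n b s0 J)%N, (4 * s_ s0 J < n)%N & 1 <= ln n%:R :> R].
Proof.
move=> n2 hm0 hJ; have n0 : (0 < n)%N by exact: leq_trans n2.
have b0 : 0 < b by exact: lt_le_trans ltr01 b_ge1.
have l2 := @ln2_ge R.
have ln_ge k : (2 ^ k <= n)%N -> k%:R * ln 2 <= ln n%:R :> R.
  by move=> kn; rewrite -ln_expn2 ler_ln ?posrE ?ltr0n ?expn_gt0 // ler_nat.
have s0R : 1 <= s0%:R :> R by rewrite ler1n.
have hm i : (s_ s0 i)%:R * ln n%:R <= (m_ n b s0 i)%:R :> R.
  apply: le_trans (_ : b * (s_ s0 i)%:R * ln n%:R <= _); last exact: le_m_.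
  rewrite -mulrA ler_peMl // mulr_ge0 ?ler0n //.
  by rewrite ln_ge0 // ler1n.
have hm0' : ln n%:R <= (m_ n b s0 0)%:R :> R.
  apply: le_trans (hm 0%N); rewrite s_E expr0 mul1r ler_peMl //.
  by rewrite ln_ge0 // ler1n.
have m0n : (4 * m_ n b s0 0 <= n)%N.
  by rewrite -(ler_nat R) natrM; lra.
have n4 : (4 <= n)%N.
  have : (0 < m_ n b s0 0)%N.
    by rewrite -(ltr_nat R); apply: lt_le_trans hm0'; have := ln_ge 1%N n2; lra.
  by lia.
have n8 : (8 <= n)%N.
  have : (1 < m_ n b s0 0)%N.
    by rewrite -(ltr_nat R); apply: lt_le_trans hm0'; have := ln_ge 2%N n4; lra.
  by lia.
have lnn : 2 <= ln n%:R :> R by have := ln_ge 3%N n8; lra.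
have y0 : 0 < b * s0%:R * ln n%:R by rewrite !mulr_gt0 //; lra.
have nR : 0 < n%:R :> R by rewrite ltr0n.
(* J + 1 is at most the ceiling minus one, hence strictly below the logarithm. The spare factor 2
   absorbs the ceiling in m_J and, with ln n >= 2, gives 4 s_J < n. *)
have key : 2 ^+ J.+1 * (b * s0%:R * ln n%:R) < n%:R.
  rewrite -ltr_pdivlMr // lt_exp2 ?divr_gt0 //.
  have /andP[h _] := ceil_itv (log2 (n%:R / (b * s0%:R * ln n%:R))).
  apply: le_lt_trans h; rewrite -/(J_of n b s0) pmulrn ler_int.
  by move: hJ; lia.
have half : b * (s_ s0 J)%:R * ln n%:R < n%:R / 2.
  by rewrite s_E ltr_pdivlMr //; move: key; rewrite exprS; lra.
have sJ : 0 < (s_ s0 J)%:R :> R by rewrite ltr0n s_gt0.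
split.
- have n2R : 2 <= n%:R :> R by rewrite ler_nat.
  by rewrite -(ltr_nat R); have := m_lt J n0; lra.
- rewrite -(ltr_nat R); apply: lt_le_trans (hm J); rewrite mulr_gt0 //; lra.
- rewrite -(ltr_nat R) natrM.
  have : (s_ s0 J)%:R * 2 <= b * (s_ s0 J)%:R * ln n%:R.
    rewrite -mulrA; apply: le_trans (_ : (s_ s0 J)%:R * ln n%:R <= _).
      by rewrite ler_wpM2l // ltW.
    by rewrite ler_peMl // mulr_ge0 ?(ltW sJ) //; lra.
  by lra.
- lra.
Qed.

(** With l = ln (n / 4s) <= ln n, the lower bound on m gives s <= m / (b l): this trades the entropy
    of the net, proportional to s, for a multiple of m, and [gamma_of] is what remains. *)
Lemma gamma_exponent m (delta : R) : let s := s_ s0 J in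
  (4 * s < n)%N -> b * s%:R * ln n%:R <= m%:R -> 0 < delta <= 12 ->
  (4 * s)%:R * (1 + ln (12 / delta) + ln (n%:R / (4 * s)%:R)) - m%:R * c0 (delta / 2)
    <= - (gamma_of n s b delta * m%:R).
Proof.
move=> s sn hm /andP[d0 d1]; rewrite /gamma_of natrM.
have sR : 0 < s%:R :> R by rewrite ltr0n s_gt0.
have b0 : 0 < b by exact: lt_le_trans ltr01 b_ge1.
have k1 : 1 < n%:R / (4 * s%:R) :> R.
  by rewrite ltr_pdivlMr ?mulr_gt0 // mul1r -natrM ltr_nat.
have nR : 0 < n%:R :> R by rewrite ltr0n; exact: leq_ltn_trans sn.
set l := ln (n%:R / _); have l0 : 0 < l by exact: ln_gt0.
have hl : l <= ln n%:R.
  rewrite ler_ln ?posrE //; last by exact: lt_trans k1.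
  rewrite ler_pdivrMr ?mulr_gt0 // ler_peMr ?ler0n // -natrM ler1n.
  by rewrite muln_gt0 s_gt0.
set D := ln (12 / delta).
have D0 : 0 <= D by rewrite ln_ge0 // ler_pdivlMr // mul1r.
have -> : - ((c0 (delta / 2) - 4 / b * (1 + (1 + D) / l)) * m%:R) =
   4 * (m%:R / (b * l)) * (1 + D + l) - m%:R * c0 (delta / 2).
  by field; rewrite !gt_eqF.
rewrite lerD2r ler_wpM2r //; first by lra.
rewrite ler_pM2l // ler_pdivlMr ?mulr_gt0 //; apply: le_trans hm.
by rewrite mulrCA mulrA ler_wpM2l // mulr_ge0 // ltW.
Qed.

(** The m_i grow geometrically, so all levels together cost about twice the last one; J + 1 <= 2^J
    and B >= 1 absorb the ceilings, the trial points and the evaluation at the iterate. *)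
Lemma cost_le : (0 < n)%N -> 1 <= ln n%:R :> R ->
  (1 + \sum_(i < J.+1) (minn (m_ n b s0 i) n + 1))%N%:R <= 5 * b * (2 ^+ J * s0%:R) * ln n%:R.
Proof.
move=> n0 lnn; set B := b * s0%:R * ln n%:R.
have s0R : 1 <= s0%:R :> R by rewrite ler1n.
have B1 : 1 <= B by rewrite !mulr_ege1.
have term i : (minn (m_ n b s0 i) n + 1)%N%:R <= 2 ^+ i * B + 2.
  rewrite natrD; have : (minn (m_ n b s0 i) n)%:R <= (m_ n b s0 i)%:R :> R.
    by rewrite ler_nat geq_minl.
  have := m_lt i n0; rewrite s_E /B.
  have -> : b * (2 ^+ i * s0%:R) * ln n%:R = 2 ^+ i * (b * s0%:R * ln n%:R) by ring.
  by lra.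
have total j : (\sum_(i < j.+1) (minn (m_ n b s0 i) n + 1))%N%:R <=
    (2 ^+ j.+1 - 1) * B + 2 * j.+1%:R :> R.
  elim: j => [|j IHj]; first by rewrite big_ord_recl big_ord0 addn0; have := term 0%N; lra.
  rewrite big_ord_recr natrD; apply: le_trans (lerD IHj (term j.+1)) _.
  by rewrite -[j.+2%:R]natr1 [2 ^+ j.+2]exprS; lra.
have J2 : J.+1%:R <= 2 ^+ J :> R by rewrite -natrX ler_nat ltn_expl.
have -> : 5 * b * (2 ^+ J * s0%:R) * ln n%:R = 5 * (2 ^+ J * B) by rewrite /B; ring.
have P1 : 2 ^+ J <= 2 ^+ J * B by rewrite ler_peMr // exprn_ge0.
have P0 : 1 <= (2 : R) ^+ J by rewrite exprn_ege1 // ler1n.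
rewrite natrD; have := total J; rewrite exprS.
by lra.
Qed.

End Levels.

Section Deterministic.
Context {R : realType}.

(** Randomness is left only in the hypothesis [rip]. The number of iterations and the cost of each
    are both proportional to 2^J, whence the square in the constant. *)
Lemma zoro_fa_complexity (n : nat) (f : 'cV[R]_n -> R) (flow : R) (x0 : 'cV[R]_n)
    (b C theta L sigma0 eps p delta : R) (s0 : nat) (z : 'M[R]_n) :
  let X := (theta + 1) ^+ 2 / (1 - 2 * theta) * (L / sigma0) in
  let J := `|jstar theta p L sigma0 s0|%N in
  1 <= b -> 0 < theta < 1 / 2 -> 0 < L -> 0 < sigma0 ->
  (forall x, differentiable f x) -> 0 < eps -> (0 < s0)%N ->
  (forall x y, norm2 (nabla f x - nabla f y) <= L * norm2 (x - y)) ->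
  (forall x, flow <= f x) -> 0 < p < 1 ->
  (forall x (j : nat), (1 <= j <= n)%N ->
    kth_largest (nabla f x) j <= norm2 (nabla f x) / (j%:R `^ (1 / p))) ->
  1 <= jstar theta p L sigma0 s0 ->
  s0%:R <= s_of theta p <= C * s0%:R ->
  forall mn : (m_ n b s0 J < n)%N, (0 < m_ n b s0 J)%N -> (4 * s_ s0 J < n)%N ->
  1 <= ln n%:R :> R ->
  (forall i l, z i l = 1 \/ z i l = -1) -> 0 <= delta <= 5 / 22 ->
  rip (sensing (ltnW mn) z) (4 * s_ s0 J) delta ->
  forall xs gs js, zoro_fa_run f x0 eps theta b sigma0 s0 z xs gs js ->
  exists2 T, hitting_time f eps xs T &
    (FE n b s0 js T <= (10 * b * sigma0 * (4 + 2 * C + 2 * X) ^+ 2 * (f x0 - flow)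
                        * s_of theta p * ln n%:R * eps ^- 2)%:E)%E.
Proof.
move=> X J b1 t01 L0 sg0 df e0 s00 lip flow_le p01 decay j1 sC mn m0 sn lnn zpm d01 ripZ.
move=> xs gs js run; have /andP[t0 t1] := t01.
have b0 : 0 < b by lra.
(* This makes the acceptance threshold for sigma_J also imply L <= sigma_J, which the finite
   difference error relies on. *)
have q1 : 1 <= (theta + 1) ^+ 2 / (1 - 2 * theta).
  rewrite ler_pdivlMr; last by lra.
  by have := sqr_ge0 theta; lra.
have X0 : 0 < X.
  by rewrite mulr_gt0 ?divr_gt0 ?exprn_gt0 //; lra.
have [JE J1 sJ XJ JA] := jstar_spec s00 X0 j1 sC.
rewrite -/X -/J in sJ XJ JA J1.
have sigmaJ : (theta + 1) ^+ 2 / (1 - 2 * theta) * L <= sigma_ sigma0 J.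
  by rewrite /sigma_ -ler_pdivrMr //; apply: le_trans XJ; rewrite /X mulrA.
have LJ : L <= sigma_ sigma0 J by apply: le_trans sigmaJ; rewrite ler_peMl // ltW.
have accJ k : eps < norm2 (nabla f (xs k)) -> accepted f eps sigma0 (xs k) J (gs k J).
  move=> hk; apply: (accurate_accepted df L0 lip t01 e0 sg0 sigmaJ (ltW hk)).
  have [_ /(_ k J)[/(_ mn) hest _] _] := run.
  apply: (compressed_accuracy df L0 lip t01 e0 sg0 p01 _ zpm m0 _ _ _ d01 ripZ LJ (ltW hk) hest).
  - exact: decay.
  - exact: s_gt0.
  - by apply: leq_trans (ltnW sn); rewrite leq_pmull.
  - by rewrite s_E.
have [T [hT Tc before]] := run_hitting e0 sg0 flow_le run accJ.
exists T => //; apply: le_trans (FE_le b s0 before) _; rewrite lee_fin.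
have n0 : (0 < n)%N by exact: (leq_ltn_trans (leq0n _) mn).
have cost := cost_le J b1 s00 n0 lnn.
have s0R : 0 < s0%:R :> R by rewrite ltr0n.
have /andP[sl su] := sC.
set A := 4 + 2 * C + 2 * X in JA *.
have D0 : 0 <= f x0 - flow by rewrite subr_ge0.
set D := f x0 - flow in Tc D0 *.
have J0 : 0 < (2 : R) ^+ J by rewrite exprn_gt0.
have T_le : T%:R <= 2 * (2 ^+ J * sigma0) * D * eps ^- 2.
  have S0 : 0 < 2 ^+ J * sigma0 by rewrite mulr_gt0.
  rewrite /sigma_ in Tc; move: (2 ^+ J * sigma0) S0 Tc => S S0 Tc.
  have -> : T%:R = T%:R * ((2 * S)^-1 * eps ^+ 2) * (2 * S * eps ^- 2).
    by field; rewrite !gt_eqF.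
  have -> : 2 * S * D * eps ^- 2 = D * (2 * S * eps ^- 2) by ring.
  by rewrite ler_wpM2r // !mulr_ge0 ?invr_ge0 ?exprn_ge0 // ltW.
apply: le_trans (ler_pM _ _ T_le cost) _ => //.
clearbody A D; move: (2 ^+ J) (s_of theta p) (ln n%:R) J0 JA lnn sl => PJ S l PJ0 PJA l1 sS.
have -> : 2 * (PJ * sigma0) * D * eps ^- 2 * (5 * b * (PJ * s0%:R) * l) =
  10 * b * sigma0 * D * l * eps ^- 2 * (PJ * (PJ * s0%:R)) by ring.
have -> : 10 * b * sigma0 * A ^+ 2 * D * S * l * eps ^- 2 =
  10 * b * sigma0 * D * l * eps ^- 2 * (A * (A * S)) by ring.
rewrite ler_wpM2l //.
  rewrite !mulr_ge0 // ?invr_ge0 ?exprn_ge0 // ?(ltW b0) ?(ltW sg0) ?(ltW e0) //.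
  exact: le_trans ler01 l1.
by apply: ler_pM => //; rewrite ?mulr_ge0 ?(ltW PJ0) ?(ltW s0R) // ler_pM ?(ltW PJ0) ?(ltW s0R).
Qed.

End Deterministic.

Theorem corollary4 (R : realType) (b C theta L sigma0 Delta : R)
    (hb1 : 1 <= b) (hC : 1 <= C) (htheta : 0 < theta < 1 / 2)
    (hL : 0 < L) (hsigma0 : 0 < sigma0) :
  exists K : R,
  forall (n : nat) (f : 'cV[R]_n -> R) (flow : R) (x0 : 'cV[R]_n)
    (eps p : R) (s0 : nat)
    (d : measure_display) (Om : measurableType d) (P : probability Om R)
    (z : 'I_n * 'I_n -> {RV P >-> R}),
  (2 <= n)%N ->
  (forall x, differentiable f x) ->
  f x0 - flow = Delta ->
  0 < eps < 1 ->
  (1 <= s0)%N ->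
  (m_ n b s0 0)%:R <= n%:R / 4 :> R ->
  iid_rademacher_vectors z ->
  (forall x y, norm2 (nabla f x - nabla f y) <= L * norm2 (x - y)) ->
  (forall x, flow <= f x) ->
  0 < p < 1 ->
  (forall x (j : nat), (1 <= j <= n)%N ->
    kth_largest (nabla f x) j <= norm2 (nabla f x) / (j%:R `^ (1 / p))) ->
  let js := jstar theta p L sigma0 s0 in
  1 <= js < J_of n b s0 - 1 ->
  s0%:R <= s_of theta p <= C * s0%:R ->
  let delta : R := 226 / 10 ^+ 3 + 64 / 10 ^+ 5 in
  c1 n (s_ s0 `|js|%N) delta <= b ->
  let good := [set w : Om |
    forall xs gs jk,
      zoro_fa_run f x0 eps theta b sigma0 s0 (sample z w) xs gs jk ->
      exists2 T, hitting_time f eps xs T &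
        (FE n b s0 jk T <= (K * s_of theta p * ln n%:R * eps ^- 2)%:E)%E] in
  measurable good /\
  ((1 - 2 * expR (- (gamma_of n (s_ s0 `|js|%N) b delta
                     * (m_ n b s0 `|js|%N)%:R)))%:E <= P good)%E.
Proof.
set X := (theta + 1) ^+ 2 / (1 - 2 * theta) * (L / sigma0).
exists (10 * b * sigma0 * (4 + 2 * C + 2 * X) ^+ 2 * Delta).
move=> n f flow x0 eps p s0 d Om P z n2 df <- /andP[e0 _] s00 hm0 iid_z lip flow_le.
move=> p01 decay js /andP[js1 jsJ] sC delta _ good.
set J := `|js|%N.
have jsE : js = J%:Z by rewrite /J gez0_abs // (le_trans _ js1).
have hJ : J%:Z < J_of n b s0 - 1 by rewrite -jsE.
have [mn m0 sn lnn] := level_bounds hb1 s00 n2 hm0 hJ.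
have [d1 d2] : 2 / 9 <= delta /\ delta <= 5 / 22 by rewrite /delta; split; lra.
clearbody delta.
have d0 : 0 < delta by lra.
pose Q (s : {ffun 'I_n -> {ffun 'I_n -> bool}}) : bool := `[<
  forall xs gs jk,
    zoro_fa_run f x0 eps theta b sigma0 s0 (sign_mx s) xs gs jk ->
    exists2 T, hitting_time f eps xs T &
      (FE n b s0 jk T <= (10 * b * sigma0 * (4 + 2 * C + 2 * X) ^+ 2 * (f x0 - flow)
         * s_of theta p * ln n%:R * eps ^- 2)%:E)%E >].
have goodE : good = [set w | Q (sample_signs z w)].
  apply/seteqP; split=> w; rewrite /good /Q /= (sample_sign_mx iid_z).
    by move=> h; apply/asboolP.
  by move/asboolP.
have [mQ PQ] := probability_signs_event iid_z Q.
rewrite goodE; split=> //; apply: le_trans PQ; rewrite lee_fin lerD2l lerN2.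
rewrite ler_pdivrMr ?exprn_gt0 // mulrC.
have s_pos : (0 < 4 * s_ s0 J)%N by rewrite muln_gt0 s_gt0.
have d12 : 2 / 9 <= delta <= 5 / 22 by rewrite d1.
(* Every sample outside the good event violates the isometry at order 4 s_J, so it is enough to
   count those. *)
apply: le_trans (le_trans (card_rip_fail (ltnW mn) m0 s_pos (ltnW sn) d12) _).
  rewrite ler_nat; apply/subset_leq_card/fintype.subsetP => s; rewrite !inE.
  apply: contra => /asboolP ripZ; apply/asboolP.
  have zpm i l : sign_mx (R := R) s i l = 1 \/ sign_mx (R := R) s i l = -1.
    by rewrite mxE /sign; case: (s i l); [left | right].
  have dl : 0 <= delta <= 5 / 22 by rewrite ltW.
  exact: (zoro_fa_complexity hb1 htheta hL hsigma0 df e0 s00 lip flow_le p01 decay js1 sC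
    m0 sn lnn zpm dl ripZ).
rewrite ler_pM2l ?exprn_gt0 // ler_pM2l // ler_expR.
have d12' : 0 < delta <= 12 by rewrite d0 /=; lra.
exact: (gamma_exponent hb1 s00 sn (le_m_ _ _ _ _) d12').
Qed.
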